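(* Let $(\lambda_n)_{n\ge 1}$ be a sequence of non-zero complex numbers with $|\lambda_n|\to+\infty$ such that for every $M>0$ there exists a subsequence $(\mu_n)$ of $(\lambda_n)$ satisfying (i) $|\mu_{n+1}|-|\mu_n|>M$ for every $n=1,2,\ldots$, and (ii) $\sum_{n=1}^{+\infty}\frac{1}{|\mu_n|}=+\infty$. Then the set $\bigcap_{a\in\mathbb{C}\setminus\{0\}}HC(\{T_{\lambda_n a}\})$ is a $G_\delta$ and dense subset of $H(\mathbb{C})$.
   Context: $H(\mathbb{C})$ is the space of entire functions endowed with the topology of local uniform convergence. For $b\in\mathbb{C}\setminus\{0\}$, $T_b:H(\mathbb{C})\to H(\mathbb{C})$ is the translation operator $T_b(f)(z)=f(z+b)$. For a fixed $a\in\mathbb{C}\setminus\{0\}$, $HC(\{T_{\lambda_n a}\})$ denotes the set of all $f\in H(\mathbb{C})$ such that the set $\{T_{\lambda_n a}(f): n=1,2,\ldots\}$ is dense in $H(\mathbb{C})$. *)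

(* Defs.v *)
From HB Require Import structures.
From mathcomp Require Import all_boot all_order all_algebra.
From mathcomp Require Import complex.
From mathcomp Require Import all_classical all_reals all_analysis.

Set Implicit Arguments.
Unset Strict Implicit.
Unset Printing Implicit Defensive.

Import Order.TTheory GRing.Theory Num.Theory.
Import numFieldNormedType.Exports.

Local Open Scope classical_set_scope.
Local Open Scope ring_scope.

(* Packing R[i] as a numClosedFieldType gives it the norm topology that
   MathComp-Analysis puts on every numFieldType; R[i] itself has none. *)
Definition Cplx (R : realType) : numClosedFieldType := R[i].

(* The norm of MathComp on Cplx R is complex-valued; this one is real-valued. *)
Definition cmod (R : realType) (z : Cplx R) : R := ComplexField.Normc.normc z.

Lemma cmodE (R : realType) (z : Cplx R) :
  `|z| = real_complex R (cmod z) :> R[i].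
Proof. by []. Qed.

(* Derivability in direction 1 over the scalar field Cplx R is complex
   differentiability. *)
Definition entire (R : realType) (f : Cplx R -> Cplx R) : Prop :=
  forall z : Cplx R, derivable (f : Cplx R -> (Cplx R)^o) z 1.

(* The topology on this type is the one induced by uniform convergence on
   compact sets, i.e., by local uniform convergence, Cplx R being locally
   compact. *)
Definition H (R : realType) : topologicalType :=
  set_type [set f : {family compact, Cplx R -> Cplx R} | entire f].

Definition Hfun (R : realType) (f : H R) : Cplx R -> Cplx R := set_val f.

Lemma entire_Hfun (R : realType) (f : H R) : entire (Hfun f).
Proof. exact: set_mem (valP f). Qed.
Arguments entire_Hfun {R} f.

Lemma entire_translate (R : realType) (b : Cplx R) (f : Cplx R -> Cplx R) :
  entire f -> entire (fun z => f (z + b)).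
Proof.
move=> ef z; have := ef (z + b); rewrite /derivable.
set u := (X in cvg (X @ _) -> _); set v := (X in _ -> cvg (X @ _)).
by have -> : u = v by apply/funext => h; rewrite /u /v /= addrA.
Qed.
Arguments entire_translate {R} b {f}.

Definition translation (R : realType) (b : Cplx R) (f : H R) : H R :=
  exist _ (fun z => Hfun f (z + b))
    (mem_set (entire_translate b (entire_Hfun f))).

Definition HC (R : realType) (lambda : (Cplx R)^nat) (a : Cplx R) : set (H R) :=
  [set f | dense [set translation (lambda n * a) f | n in [set: nat]]].

(* Main.v *)
(* By Baire's theorem it suffices to find, for entire g and a polynomial p, an
   entire f close to g on a given disc such that every a in a given annulus has
   a translate f(. + lambda_n a), n bounded, close to p on a given disc.

   Discs of fixed radius centred at points lambda_n a', with a' ranging over a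
   finite set A_n, are arranged to be far apart while each a in the annulus
   satisfies |lambda_n (a - a')| <= delta for some n and some a' in A_n; then f
   is taken close to p(. - lambda_n a') on these discs.  For such an
   arrangement, A_n is contained in a thin annulus near the circle of radius
   rho_n, with rho_n increasing: as |lambda_n| has large gaps, the discs for
   different n are separated by their moduli alone.  A thin annulus is filled
   by a boundedly long run of consecutive n, each of which uses one residue
   class of a square lattice of mesh comparable to 1 / |lambda_n|.  The
   thickness gained at each run is also comparable to 1 / |lambda_n|, so
   divergence of the series lets rho_n cross the whole annulus.

   The complex analysis needed (density of polynomials, closedness of entire
   functions under locally uniform limits) rests on an integral-free form of
   Goursat's theorem, in which trapezoidal Riemann sums along the boundary of a
   Lipschitz image of a square tend to 0: these sums vanish exactly on affine
   functions.  Hence the interpolation polynomials of f at the 2^m-th roots of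
   unity converge to f. *)
Require Import Defs.
From mathcomp Require Import all_boot all_order all_algebra.
From mathcomp Require Import all_classical all_reals all_analysis.
From mathcomp Require Import borel_hierarchy.
From mathcomp Require Import complex zify ring lra.

Set Implicit Arguments.
Unset Strict Implicit.
Unset Printing Implicit Defensive.

Import Order.TTheory GRing.Theory Num.Theory.
Import numFieldNormedType.Exports.

Local Open Scope classical_set_scope.
Local Open Scope ring_scope.

Local Notation Re := (@complex.Re _).
Local Notation Im := (@complex.Im _).

(** * The complex modulus *)

Section Modulus.
Variable R : realType.
Local Notation C := (Cplx R).
Implicit Types (x y z w : C) (r : R).

Definition cplx (r : R) : C := real_complex R r.

Lemma cplxD r s : cplx (r + s) = cplx r + cplx s.
Proof. exact: (rmorphD (real_complex R)). Qed.

Lemma cplxB r s : cplx (r - s) = cplx r - cplx s.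
Proof. exact: (rmorphB (real_complex R)). Qed.

Lemma cplxM r s : cplx (r * s) = cplx r * cplx s.
Proof. exact: (rmorphM (real_complex R)). Qed.

Lemma cplx_nat n : cplx n%:R = n%:R.
Proof. exact: (rmorph_nat (real_complex R)). Qed.

Lemma cmod_ge0 z : 0 <= cmod z.
Proof. by case: z => a b; exact: sqrtr_ge0. Qed.

Lemma cmod0 : cmod (0 : C) = 0.
Proof. exact: ComplexField.Normc.normc0. Qed.

Lemma cmod1 : cmod (1 : C) = 1.
Proof. exact: ComplexField.Normc.normc1. Qed.

Lemma cmodM x y : cmod (x * y) = cmod x * cmod y.
Proof. exact: ComplexField.Normc.normcM. Qed.

Lemma cmodV x : cmod x^-1 = (cmod x)^-1.
Proof. exact: ComplexField.Normc.normcV. Qed.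

Lemma cmodN x : cmod (- x) = cmod x.
Proof. exact: normcN. Qed.

Lemma cmodB x y : cmod (x - y) = cmod (y - x).
Proof. by rewrite -cmodN opprB. Qed.

Lemma cmodX x n : cmod (x ^+ n) = cmod x ^+ n.
Proof. by elim: n => [|n IH]; rewrite ?expr0 ?cmod1// !exprS cmodM IH. Qed.

Lemma cmod_eq0 x : (cmod x == 0) = (x == 0).
Proof.
by apply/eqP/eqP => [/ComplexField.Normc.eq0_normc|->]; rewrite ?cmod0.
Qed.

Lemma cmod_gt0 x : (0 < cmod x) = (x != 0).
Proof. by rewrite lt_def cmod_ge0 cmod_eq0 andbT. Qed.

Lemma ler_cmodD x y : cmod (x + y) <= cmod x + cmod y.
Proof. exact: le_normcD. Qed.

Lemma ler_cmodB x y : cmod (x - y) <= cmod x + cmod y.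
Proof. by rewrite -(cmodN y) ler_cmodD. Qed.

Lemma cmod_dist_triangle y x z : cmod (x - z) <= cmod (x - y) + cmod (y - z).
Proof. by rewrite -[x - z](subrKA y) ler_cmodD. Qed.

Lemma cmod_cplx r : cmod (cplx r) = `|r|.
Proof. by rewrite /cmod /= expr0n addr0 sqrtr_sqr. Qed.

Lemma cmod_nat n : cmod (n%:R : C) = n%:R.
Proof. by rewrite -cplx_nat cmod_cplx ger0_norm. Qed.

Lemma ler_cmod_sum (I : Type) (s : seq I) (P : pred I) (F : I -> C) :
  cmod (\sum_(i <- s | P i) F i) <= \sum_(i <- s | P i) cmod (F i).
Proof.
elim/big_ind2: _ => [|x u y v xu yv|//]; first by rewrite cmod0.
by rewrite (le_trans (ler_cmodD _ _))// lerD.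
Qed.

Lemma ler_cmod_ReIm z : cmod z <= `|Re z| + `|Im z|.
Proof.
case: z => a b; rewrite /cmod /=.
rewrite -[leRHS]ger0_norm ?addr_ge0// -sqrtr_sqr ler_wsqrtr//.
rewrite sqrrD !real_normK ?num_real// -subr_ge0.
have : 0 <= `|a| * `|b| by rewrite mulr_ge0.
set c := `|a| * `|b|; rewrite mulr2n; lra.
Qed.

Lemma ler_Re_cmod z : `|Re z| <= cmod z.
Proof.
by case: z => a b; rewrite /cmod /= -sqrtr_sqr ler_wsqrtr// lerDl sqr_ge0.
Qed.

Lemma ler_Im_cmod z : `|Im z| <= cmod z.
Proof.
by case: z => a b; rewrite /cmod /= -sqrtr_sqr ler_wsqrtr// lerDr sqr_ge0.
Qed.

Lemma ReB x y : Re (x - y : C) = Re x - Re y.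
Proof. by case: x y => a b [c d]. Qed.

Lemma ImB x y : Im (x - y : C) = Im x - Im y.
Proof. by case: x y => a b [c d]. Qed.

Lemma nbhs_cmodP z (A : set C) :
  nbhs z A <-> exists2 e : R, 0 < e & forall w, cmod (w - z) < e -> A w.
Proof.
split=> [/nbhs_ballP[e /= e0 eA]|[e e0 eA]].
  have eE : e = cplx (Re e) by move/gtr0_real/RRe_real : e0.
  exists (Re e) => [|w wz]; first by rewrite -ltcR -[ltRHS]/(cplx (Re e)) -eE.
  by apply: eA; rewrite -ball_normE /ball_ /= distrC cmodE eE ltcR.
apply/nbhs_ballP; exists (cplx e); first by rewrite /= ltcR.
by move=> w; rewrite -ball_normE /ball_ /= distrC cmodE ltcR => /eA.
Qed.

Lemma nbhs_cmod_lt z (e : R) : 0 < e -> nbhs z [set w | cmod (w - z) < e].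
Proof. by move=> e0; apply/nbhs_cmodP; exists e. Qed.

Lemma continuous_cmodP (f : C -> C) z :
  {for z, continuous f} <-> forall e, 0 < e ->
    exists2 d, 0 < d & forall w, cmod (w - z) < d -> cmod (f w - f z) < e.
Proof.
split=> [cf e e0|cf A /nbhs_cmodP[e e0 eA]].
  by have /cf/nbhs_cmodP[d d0 dA] := nbhs_cmod_lt (f z) e0; exists d.
by have [d d0 dA] := cf _ e0; apply/nbhs_cmodP; exists d => // w /dA/eA.
Qed.

(** Any compact set containing the disc serves below; here it is the image of a square under
    [(a, b) |-> a + ib]. *)
Lemma closed_ball_compact (r : R) :
  exists2 K : set C, compact K & forall z, cmod z <= r -> K z.
Proof.
pose g (p : R * R) : C := Complex p.1 p.2.
exists (g @` (`[- r, r]%classic `*` `[- r, r]%classic)); last first.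
  move=> [a b] abr; exists (a, b) => //; split=> /=;
  rewrite in_itv /= -ler_norml.
    by apply: le_trans abr; exact: (ler_Re_cmod (Complex a b)).
  by apply: le_trans abr; exact: (ler_Im_cmod (Complex a b)).
apply: continuous_compact; last by apply: compact_setX; exact: segment_compact.
apply: continuous_subspaceT => -[a b] A /nbhs_cmodP[e e0 eA].
have e20 : 0 < e / 2 by lra.
exists (ball a (e / 2), ball b (e / 2)) => /=.
  by split; apply: nbhsx_ballx.
move=> [c d] /= []; rewrite -!ball_normE /ball_ /= => ac bd; apply: eA.
apply: (le_lt_trans (ler_cmod_ReIm _)); rewrite /= distrC [X in _ + X]distrC.
by lra.
Qed.

Lemma compact_cmod_bounded (K : set C) :
  compact K -> exists r : R, forall z, K z -> cmod z <= r.
Proof.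
move=> /compact_near_coveringP/(_ R (pinfty_nbhs R) (fun r z => cmod z <= r) _).
case=> [x _|M [_ /(_ (M + 1))]]; last first.
  by rewrite ltrDl ltr01 => /(_ erefl) KM; exists (M + 1).
exists ([set y | cmod (y - x) < 1], [set r | cmod x + 1 < r]) => /=.
  split; first exact: nbhs_cmod_lt.
  by exists (cmod x + 1); split; first exact: num_real.
case=> y r /= [yx xr]; rewrite -(subrK x y).
by apply: (le_trans (ler_cmodD _ _)); lra.
Qed.

End Modulus.

(** * Entire functions *)

Section Entire.
Variable R : realType.
Local Notation C := (Cplx R).
Implicit Types (f g : C -> C) (z w : C).

(** Complex differentiability in the real-valued modulus, multiplied through by [cmod (w - z)] so
    that the case [w = z] is included. *)
Definition cdiff f z := exists d : C, forall e : R, 0 < e ->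
  exists2 r : R, 0 < r & forall w, cmod (w - z) < r ->
    cmod (f w - f z - d * (w - z)) <= e * cmod (w - z).

Lemma derivable_cdiff f z : derivable (f : C -> C^o) z 1 <-> cdiff f z.
Proof.
split=> [/cvg_ex[d fd]|[d fd]]; [|apply/cvg_ex]; exists d.
  move=> e e0; have /fd := nbhs_cmod_lt (d : C) e0.
  rewrite nbhs_simpl /= => /nbhs_cmodP[r r0 rE]; exists r => // w wz.
  have [->|wz0] := eqVneq w z; first by rewrite !subrr mulr0 subrr cmod0 mulr0.
  have := rE (w - z); rewrite subr0 => /(_ wz) /=.
  rewrite /GRing.scale /= mulr1 subrK subr_eq0 => /(_ wz0) /ltW.
  have wz1 : w - z != 0 by rewrite subr_eq0.
  rewrite -(ler_pM2r (x := cmod (w - z))) ?cmod_gt0// -cmodM.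
  by rewrite mulrBl mulrAC mulVf// mul1r.
move=> A /nbhs_cmodP[e e0 eA].
have e20 : 0 < e / 2 by lra.
have [r r0 rE] := fd _ e20.
rewrite nbhs_simpl /=; apply/nbhs_cmodP; exists r => // h; rewrite subr0 => hr h0.
apply: eA; rewrite /GRing.scale /= mulr1.
rewrite -(ltr_pM2r (x := cmod h)) ?cmod_gt0// -cmodM mulrBl mulrAC mulVf// mul1r.
have := rE (h + z); rewrite addrK => /(_ hr) /le_lt_trans; apply.
by rewrite ltr_pM2r ?cmod_gt0//; lra.
Qed.

Lemma entireP f : entire f <-> forall z, cdiff f z.
Proof. by split=> ef z; have := ef z; rewrite derivable_cdiff. Qed.

Lemma entire_cst (c : C) : entire (fun=> c).
Proof. by move=> z; exact: derivable_cst. Qed.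

Lemma entire_id : entire (fun z : C => z).
Proof. by move=> z; exact: derivable_id. Qed.

Lemma entireD f g : entire f -> entire g -> entire (fun z => f z + g z).
Proof. by move=> ef eg z; exact: (derivableD (ef z) (eg z)). Qed.

Lemma entireB f g : entire f -> entire g -> entire (fun z => f z - g z).
Proof. by move=> ef eg z; exact: (derivableB (ef z) (eg z)). Qed.

Lemma entireM f g : entire f -> entire g -> entire (fun z => f z * g z).
Proof. by move=> ef eg z; exact: (derivableM (ef z) (eg z)). Qed.

Lemma entire_horner_comp f (p : {poly C}) : entire f -> entire (fun z => p.[f z]).
Proof.
move=> ef; elim/poly_ind: p => [|p c IH].
  rewrite (_ : (fun _ => _) = fun=> 0); first exact: entire_cst.
  by apply/funext => z; rewrite horner0.
rewrite (_ : (fun _ => _) = fun z => p.[f z] * f z + c).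
  by apply: (entireD (entireM IH ef)); exact: entire_cst.
by apply/funext => z; rewrite hornerMXaddC.
Qed.

Lemma entire_horner (p : {poly C}) : entire (fun z => p.[z]).
Proof. exact: entire_horner_comp entire_id. Qed.

Lemma cdiff_divided_difference f z w :
  entire f -> w != z -> cdiff (fun u => (f u - f z) / (u - z)) w.
Proof.
move=> ef wz; apply/derivable_cdiff; apply: derivableM.
  by apply: derivableB; [exact: ef|exact: derivable_cst].
apply: derivableV; first by rewrite subr_eq0.
by apply: derivableB; [exact: derivable_id|exact: derivable_cst].
Qed.

Lemma cdiff_continuous f z : cdiff f z -> {for z, continuous f}.
Proof.
move=> [d fd]; apply/continuous_cmodP => e e0.
have [r r0 rE] := fd _ ltr01.
have D0 : 0 < cmod d + 1 by rewrite ltr_wpDl ?cmod_ge0.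
exists (Num.min r (e / (cmod d + 1))); first by rewrite lt_min r0 divr_gt0.
move=> w; rewrite lt_min ltr_pdivlMr// => /andP[/rE wr we].
have -> : f w - f z = (f w - f z - d * (w - z)) + d * (w - z) by ring.
apply: (le_lt_trans (ler_cmodD _ _)); rewrite cmodM; nra.
Qed.

Lemma entire_continuous f : entire f -> continuous f.
Proof. by move=> /entireP ef z; exact: cdiff_continuous. Qed.

Lemma entire_bounded f (r : R) : entire f ->
  exists2 B : R, 0 < B & forall z, cmod z <= r -> cmod (f z) <= B.
Proof.
move=> ef; have [K cK rK] := closed_ball_compact r.
have /compact_cmod_bounded[B fB] : compact (f @` K).
  apply: continuous_compact (cK); apply: continuous_subspaceT.
  exact: entire_continuous.
exists (Num.max B 1) => [|z /rK Kz]; first by rewrite lt_max ltr01 orbT.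
by rewrite le_max fB//; exists z.
Qed.

Lemma entire_unif_continuous f (r e : R) : entire f -> 0 < e ->
  exists2 d : R, 0 < d & forall z w, cmod z <= r -> cmod (w - z) < d ->
    cmod (f w - f z) < e.
Proof.
move=> ef e0; have [K cK rK] := closed_ball_compact r.
have e20 : 0 < e / 2 by lra.
(* Compactness in near-covering form along the filter of small positive radii: a radius valid near
   each point gives one valid on all of [K]. *)
have /compact_near_coveringP/(_ R (0^'+)
  (fun d z => forall w, cmod (w - z) < d -> cmod (f w - f z) < e) _) := cK.
case=> [z Kz|d /= d0 dE].
  have /continuous_cmodP/(_ _ e20)[d d0 dE] := entire_continuous ef (x := z).
  exists ([set w | cmod (w - z) < d / 2], [set s | 0 < s < d / 2]) => /=.
    split; first by apply: nbhs_cmod_lt; lra.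
    by exists (d / 2) => /=; [lra|move=> s /=; rewrite sub0r normrN => sd s0;
      rewrite s0 (le_lt_trans (ler_norm s))].
  case=> z' s /= [zz' /andP[s0 sd]] w wz'.
  have h1 := dE w; have h2 := dE z'.
  have t1 := cmod_dist_triangle z' w z.
  have t2 := cmod_dist_triangle (f z) (f w) (f z').
  rewrite (cmodB (f z) (f z')) in t2.
  have {}h1 : cmod (f w - f z) < e / 2 by apply: h1; lra.
  have {}h2 : cmod (f z' - f z) < e / 2 by apply: h2; lra.
  lra.
exists (d / 2) => [|z w /rK Kz wz]; first by lra.
apply: (dE (d / 2)) Kz w wz; last by lra.
by rewrite /= sub0r normrN gtr0_norm; lra.
Qed.

End Entire.

(** * Goursat's theorem for Riemann sums *)

Lemma nested_intervals (R : realType) (x l : nat -> R) :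
  (forall n, 0 <= l n) -> (forall n, x n <= x n.+1) ->
  (forall n, x n.+1 + l n.+1 <= x n + l n) ->
  exists a, forall n, x n <= a <= x n + l n.
Proof.
move=> l0 xx xl.
have incr : {homo x : n m / (n <= m)%N >-> n <= m}.
  exact: (homo_leq (@lexx _ R) (@le_trans _ R)).
have decr : {homo (fun n => x n + l n) : n m / (n <= m)%N >-> m <= n}.
  apply: (homo_leq (r := fun a b : R => b <= a)) => //.
  by move=> a b c ab bc; exact: le_trans bc ab.
have ub n m : x n <= x m + l m.
  apply: le_trans (_ : x (maxn n m) <= _); first by apply: incr; rewrite leq_maxl.
  apply: le_trans (_ : x (maxn n m) + l (maxn n m) <= _); first by rewrite lerDl.
  by apply: decr; rewrite leq_maxr.
have hs : has_sup (range x).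
  by split; [exists (x 0), 0%N|exists (x 0 + l 0) => _ [n _ <-]].
exists (sup (range x)) => n; apply/andP; split.
  by apply: ub_le_sup; [exact: hs.2|exists n].
by apply: ge_sup; [exact: hs.1|move=> _ [m _ <-]].
Qed.

Lemma exists_expr_le (R : realType) (q e : R) :
  0 <= q -> q < 1 -> 0 < e -> exists n, q ^+ n <= e.
Proof.
move=> q0 q1 e0; have lim : (fun n => q ^+ n) @ \oo --> (0 : R).
  by apply: cvg_expr; rewrite ger0_norm.
have /cvgrPdist_le/(_ _ e0) := lim.
case=> n _ /(_ n (leqnn n)); rewrite /= sub0r normrN ger0_norm ?exprn_ge0// => h.
by exists n.
Qed.

Section Goursat.
Variable R : realType.
Local Notation C := (Cplx R).
Implicit Types (f g : C -> C) (u : R -> C) (x y s t : R).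

(** The trapezoidal Riemann sum of [f] along the path [u] over [[x, x + s]] with [2 ^ m] equal
    parameter steps. Recursion on halves makes it match the bisection of squares in Goursat's
    argument. *)
Fixpoint trapsum f u m x s : C :=
  if m is m'.+1 then trapsum f u m' x (s / 2) + trapsum f u m' (x + s / 2) (s / 2)
  else (f (u x) + f (u (x + s))) / 2 * (u (x + s) - u x).

Lemma halfD x s : x + s / 2 + s / 2 = x + s.
Proof. by field. Qed.

Lemma trapsumD f g u m x s :
  trapsum (fun w => f w + g w) u m x s = trapsum f u m x s + trapsum g u m x s.
Proof.
elim: m x s => [|m IH] x s /=; last by rewrite !IH addrACA.
by field.
Qed.

(** The trapezoidal rule is exact on affine functions, so the terms telescope to the increment of
    the primitive [c w + d w ^ 2 / 2]. *)
Lemma trapsum_affine (c d : C) u m x s :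
  trapsum (fun w => c + d * w) u m x s =
  (c * u (x + s) + d * u (x + s) ^+ 2 / 2) - (c * u x + d * u x ^+ 2 / 2).
Proof.
elim: m x s => [|m IH] x s /=; last by rewrite !IH halfD addrC subrKA.
by field.
Qed.

Lemma ler_trapsum f u m x s (b K : R) : 0 <= s ->
  (forall t, x <= t <= x + s -> cmod (f (u t)) <= b) ->
  (forall t t', x <= t -> t <= t' -> t' <= x + s ->
    cmod (u t' - u t) <= K * (t' - t)) ->
  cmod (trapsum f u m x s) <= b * K * s.
Proof.
elim: m x s => [|m IH] x s s0 fb uK /=.
  rewrite cmodM -mulrA; have := uK x (x + s);
    rewrite [_ + s]addrC addrK [s + _]addrC => uK'.
  apply: ler_pM; rewrite ?cmod_ge0 ?uK' ?lexx ?lerDl//.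
  rewrite cmodM cmodV cmod_nat ler_pdivrMr//.
  have := ler_cmodD (f (u x)) (f (u (x + s))).
  have := fb x; have := fb (x + s);
    rewrite !lexx !lerDl !s0 => /(_ erefl) ? /(_ erefl) ?.
  lra.
apply: (le_trans (ler_cmodD _ _)).
have {1}-> : b * K * s = b * K * (s / 2) + b * K * (s / 2) by field.
apply: lerD; apply: IH; rewrite ?divr_ge0// => *; (apply: fb || apply: uK); lra.
Qed.

Variables (f : C -> C) (gam : R -> R -> C).

(** The boundary of the parameter square is run counterclockwise: bottom, right, then top and left
    backwards. *)
Definition bdsum m x y s : C :=
  trapsum f (gam^~ y) m x s + trapsum f (gam (x + s)) m y s
  - trapsum f (gam^~ (y + s)) m x s - trapsum f (gam x) m y s.

(** The inner edges cancel in pairs. Level [m.+1] on the square and level [m] on its quarters have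
    the same mesh. *)
Lemma bdsum_quarters m x y s : bdsum m.+1 x y s =
  bdsum m x y (s / 2) + bdsum m (x + s / 2) y (s / 2)
  + bdsum m x (y + s / 2) (s / 2) + bdsum m (x + s / 2) (y + s / 2) (s / 2).
Proof. by rewrite /bdsum /= !halfD; ring. Qed.

Variable K : R.
Hypothesis K0 : 0 < K.
Hypothesis gamK : forall x y x' y', 0 <= x <= 1 -> 0 <= y <= 1 ->
  0 <= x' <= 1 -> 0 <= y' <= 1 ->
  cmod (gam x' y' - gam x y) <= K * (`|x' - x| + `|y' - y|).

(** The affine part of [f] at [gam a b] contributes nothing around a closed path. The remainder is
    at most [e * (2 * K * s)] on the square, and each of the four edges has length at most
    [K * s]. *)
Lemma ler_bdsum m x y s a b (d : C) (e r : R) :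
  0 <= x -> 0 <= y -> 0 <= s -> x + s <= 1 -> y + s <= 1 ->
  x <= a <= x + s -> y <= b <= y + s -> 2 * K * s < r -> 0 <= e ->
  (forall w, cmod (w - gam a b) < r ->
     cmod (f w - f (gam a b) - d * (w - gam a b)) <= e * cmod (w - gam a b)) ->
  cmod (bdsum m x y s) <= 8 * e * K ^+ 2 * s ^+ 2.
Proof.
move=> x0 y0 s0 xs ys ax bx sr e0 fd.
set w0 := gam a b; pose rem w := f w - f w0 - d * (w - w0).
have fE w : f w = (f w0 - d * w0 + d * w) + rem w by rewrite /rem; ring.
have near t t' : x <= t <= x + s -> y <= t' <= y + s ->
    cmod (rem (gam t t')) <= e * (2 * K * s).
  move=> tx ty; have lip : cmod (gam t t' - w0) <= 2 * K * s.
    have := gamK (x := a) (y := b) (x' := t) (y' := t').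
    have : `|t - a| <= s by rewrite ler_norml; lra.
    have : `|t' - b| <= s by rewrite ler_norml; lra.
    move=> h1 h2 h; apply: (le_trans (h _ _ _ _)); try lra.
    by rewrite [2 * K]mulrC -mulrA ler_pM2l//; lra.
  apply: (le_trans (fd _ _)); first by lra.
  by rewrite ler_wpM2l.
have hor y1 : y <= y1 <= y + s -> cmod (trapsum rem (gam^~ y1) m x s)
  <= e * (2 * K * s) * K * s.
  move=> y1E; apply: ler_trapsum => // [t tE|t t' xt tt' t's]; first exact: near.
  have := gamK (x := t) (y := y1) (x' := t') (y' := y1).
  rewrite subrr normr0 addr0 ger0_norm ?subr_ge0//; apply; lra.
have ver x1 : x <= x1 <= x + s -> cmod (trapsum rem (gam x1) m y s)
  <= e * (2 * K * s) * K * s.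
  move=> x1E; apply: ler_trapsum => // [t tE|t t' xt tt' t's]; first exact: near.
  have := gamK (x := x1) (y := t) (x' := x1) (y' := t').
  rewrite subrr normr0 add0r ger0_norm ?subr_ge0//; apply; lra.
have -> : bdsum m x y s = trapsum rem (gam^~ y) m x s + trapsum rem (gam (x
  + s)) m y s
  - trapsum rem (gam^~ (y + s)) m x s - trapsum rem (gam x) m y s.
  have tE u t : trapsum f u m t s = trapsum (fun w => (f w0 - d * w0) + d * w) u m t s
      + trapsum rem u m t s.
    by rewrite -trapsumD -(funext fE).
  by rewrite /bdsum !tE !trapsum_affine; ring.
have h1 := hor y; have h2 := hor (y + s); have h3 := ver x; have h4 := ver (x + s).
have {}h1 := h1 ltac:(lra); have {}h2 := h2 ltac:(lra).
have {}h3 := h3 ltac:(lra); have {}h4 := h4 ltac:(lra).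
have -> : 8 * e * K ^+ 2 * s ^+ 2 = e * (2 * K * s) * K * s + e * (2 * K * s) * K * s
   + e * (2 * K * s) * K * s + e * (2 * K * s) * K * s by ring.
apply: (le_trans (ler_cmodB _ _)); apply: lerD => //.
apply: (le_trans (ler_cmodB _ _)); apply: lerD => //.
by apply: (le_trans (ler_cmodD _ _)); apply: lerD.
Qed.

(** Badness asks for arbitrarily fine sums to be large, so that it passes to a quarter although each
    quarter has its own threshold on [m]. *)
Let bad (c x y s : R) := forall N, exists2 m,
  (N <= m)%N & c * s ^+ 2 < cmod (bdsum m x y s).

Let bad_quarter c x y s : 0 <= s -> bad c x y s ->
  exists p : R * R, [/\ x <= p.1, p.1 + s / 2 <= x + s, y <= p.2,
    p.2 + s / 2 <= y + s & bad c p.1 p.2 (s / 2)].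
Proof.
move=> s0 Bs; apply: contrapT => /forallNP nb.
have good x1 y1 : x <= x1 -> x1 + s / 2 <= x + s -> y <= y1 -> y1 + s / 2 <= y + s ->
    exists N, forall m, (N <= m)%N -> cmod (bdsum m x1 y1 (s / 2))
      <= c * (s / 2) ^+ 2.
  move=> h1 h2 h3 h4; have h := nb (x1, y1).
  have /existsNP[N /forall2NP hN] : ~ bad c x1 y1 (s / 2) by move=> b; apply: h.
  exists N => m Nm; case: (hN m) => [//|/negP]; by rewrite -leNgt.
have [N1 h1] := good x y ltac:(lra) ltac:(lra) ltac:(lra) ltac:(lra).
have [N2 h2] := good (x + s / 2) y ltac:(lra) ltac:(lra) ltac:(lra) ltac:(lra).
have [N3 h3] := good x (y + s / 2) ltac:(lra) ltac:(lra) ltac:(lra) ltac:(lra).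
have [N4 h4] := good (x + s / 2) (y
  + s / 2) ltac:(lra) ltac:(lra) ltac:(lra) ltac:(lra).
(* The successor forces the level to be nonzero, as [bdsum_quarters] requires. *)
have [[//|m]] := Bs (maxn (maxn N1 N2) (maxn N3 N4)).+1.
rewrite ltnS !geq_max => /andP[/andP[/h1 {}h1 /h2 {}h2] /andP[/h3 {}h3 /h4 {}h4]].
rewrite bdsum_quarters ltNge => /negP[].
have -> : c * s ^+ 2 = c * (s / 2) ^+ 2 + c * (s / 2) ^+ 2 + c * (s / 2) ^+ 2
  + c * (s / 2) ^+ 2 by field.
do 3! (apply: (le_trans (ler_cmodD _ _)); apply: lerD => //).
Qed.

Hypothesis fdiff : forall x y, 0 <= x <= 1 -> 0 <= y <= 1 -> cdiff f (gam x y).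

(** Otherwise nested bad squares shrink to a point [(a, b)], and differentiability of [f] at
    [gam a b] contradicts their badness through [ler_bdsum]. *)
Lemma discrete_goursat (e : R) : 0 < e ->
  exists N, forall m, (N <= m)%N -> cmod (bdsum m 0 0 1) <= e.
Proof.
move=> e0; apply: contrapT => /forallNP nN.
have B0 : bad e 0 0 1.
  move=> N; have /existsNP[m /not_implyP[Nm /negP]] := nN N.
  by rewrite -ltNge => h; exists m => //; rewrite expr1n mulr1.
pose l n : R := 2^-1 ^+ n.
have l0 n : 0 < l n by rewrite exprn_gt0.
have lS n : l n.+1 = l n / 2 by rewrite /l exprSr.
(* The pair [(0, 0)] is a default for squares that are not bad; every [st n] is bad, so the default
   is never taken. *)
have /choice[nxt nxtE] (np : nat * (R * R)) : exists q :
  R * R, bad e np.2.1 np.2.2 (l np.1) ->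
    [/\ np.2.1 <= q.1, q.1 + l np.1.+1 <= np.2.1 + l np.1,
     np.2.2 <= q.2, q.2 + l np.1.+1 <= np.2.2 + l np.1 & bad e q.1 q.2 (l np.1.+1)].
  case: (pselect (bad e np.2.1 np.2.2 (l np.1))) => [b|nb]; last by exists (0, 0).
  have [q hq] := bad_quarter (ltW (l0 _)) b.
  by exists q => _; rewrite lS.
pose st := fix st n := if n is n'.+1 then nxt (n', st n') else (0, 0).
have stb n : bad e (st n).1 (st n).2 (l n).
  by elim: n => [|n IH]; [|have [] := nxtE (n, st n) IH].
have [a ha] : exists a, forall n, (st n).1 <= a <= (st n).1 + l n.
  apply: nested_intervals => n; first exact: ltW.
    by have [] := nxtE (n, st n) (stb n).
  by have [] := nxtE (n, st n) (stb n).
have [b hb] : exists a, forall n, (st n).2 <= a <= (st n).2 + l n.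
  apply: nested_intervals => n; first exact: ltW.
    by have [] := nxtE (n, st n) (stb n).
  by have [] := nxtE (n, st n) (stb n).
have in01 n : [/\ 0 <= (st n).1, 0 <= (st n).2,
  (st n).1 + l n <= 1 & (st n).2 + l n <= 1].
  elim: n => [|n [i1 i2 i3 i4]]; first by rewrite /= add0r /l expr0 !lexx.
  by have [j1 j2 j3 j4 _] := nxtE (n, st n) (stb n); split;
    rewrite /= in j1 j2 j3 j4 *; lra.
have [i1 i2 i3 i4] := in01 0.
have a01 : 0 <= a <= 1 by have := ha 0; lra.
have b01 : 0 <= b <= 1 by have := hb 0; lra.
have [d fd] := fdiff a01 b01.
have K20 : 0 < 16 * K ^+ 2 by rewrite mulr_gt0// exprn_gt0.
(* With this accuracy [ler_bdsum] gives at most [e / 2] times the squared side, below the badness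
   threshold. *)
have [r r0 fr] := fd (e / (16 * K ^+ 2)) (divr_gt0 e0 K20).
have K2 : 0 < 2 * K by rewrite mulr_gt0.
have half0 : 0 <= 2^-1 :> R by rewrite invr_ge0.
have half1 : 2^-1 < 1 :> R by rewrite invf_lt1// ltr1n.
have r20 : 0 < r / 2 by rewrite divr_gt0.
have [n hn] := exists_expr_le half0 half1 (divr_gt0 r20 K2).
have nr : 2 * K * l n < r.
  by move: hn; rewrite ler_pdivlMr// -/(l n) mulrC; lra.
have [m _] := stb n 0; rewrite ltNge => /negP[].
have [j1 j2 j3 j4] := in01 n.
apply: (le_trans (ler_bdsum m j1 j2 (ltW (l0 n)) j3 j4 (ha n) (hb n) nr _ fr)).
  by rewrite divr_ge0 ?ltW.
rewrite ler_pM2r ?exprn_gt0//.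
rewrite (_ : 8 * _ * _ = e / 2); first by lra.
by field; rewrite gt_eqF.
Qed.

End Goursat.

(** * Roots of unity on the circle *)

Section Circle.
Variable R : realType.
Local Notation C := (Cplx R).
Implicit Types (s t : R) (m k : nat).

Definition circ t : C := Complex (cos (2 * pi * t)) (sin (2 * pi * t)).

Lemma circD s t : circ (s + t) = circ s * circ t.
Proof. by rewrite /circ mulrDr cosD sinD [X in Complex _ X]addrC; congr Complex;
  ring. Qed.

Lemma circ0 : circ 0 = 1.
Proof. by rewrite /circ mulr0 cos0 sin0. Qed.

Lemma circ1 : circ 1 = 1.
Proof. by rewrite /circ mulr1 mulr_natl cos2pi sin2pi. Qed.

Lemma circ_half : circ 2^-1 = -1.
Proof. by rewrite /circ mulrAC divff// mul1r cospi sinpi -[RHS]/(Complex (-1) (-0))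
  oppr0. Qed.

Lemma cmod_circ t : cmod (circ t) = 1.
Proof. by rewrite /cmod /= cos2Dsin2 sqrtr1. Qed.

Lemma circ_neq0 t : circ t != 0.
Proof. by rewrite -cmod_eq0 cmod_circ oner_eq0. Qed.

Lemma circX t n : circ t ^+ n = circ (n%:R * t).
Proof.
elim: n => [|n IH]; first by rewrite mul0r circ0.
by rewrite exprS IH -circD mulrSr mulrDl mul1r addrC.
Qed.

Lemma ler_dist_sin (x y : R) : `|sin x - sin y| <= `|x - y|.
Proof.
wlog yx : x y / y <= x.
  by move=> h; case: (leP y x) => [/h//|/ltW/h]; rewrite distrC [leRHS]distrC.
have [|c _ ->] := @MVT_segment R sin cos y x yx.
  by apply: continuous_subspaceT => z; exact: continuous_sin.
by rewrite normrM ler_piMl// cos_max.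
Qed.

Lemma ler_dist_cos (x y : R) : `|cos x - cos y| <= `|x - y|.
Proof.
wlog yx : x y / y <= x.
  by move=> h; case: (leP y x) => [/h//|/ltW/h]; rewrite distrC [leRHS]distrC.
have [|c _ ->] := @MVT_segment R cos (fun t => - sin t) y x yx.
  by apply: continuous_subspaceT => z; exact: continuous_cos.
by rewrite normrM ler_piMl// normrN sin_max.
Qed.

Lemma circ_lipschitz s t : cmod (circ s - circ t) <= 4 * pi * `|s - t|.
Proof.
apply: (le_trans (ler_cmod_ReIm _)); rewrite ReB ImB /=.
have := ler_dist_sin (2 * pi * s) (2 * pi * t).
have := ler_dist_cos (2 * pi * s) (2 * pi * t).
rewrite -mulrBr normrM [`|2 * pi|]ger0_norm ?mulr_ge0 ?pi_ge0//.
lra.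
Qed.

Definition unity_root m : C := circ (2^-1 ^+ m).

Lemma unity_rootX m : unity_root m ^+ (2 ^ m)%N = 1.
Proof. by rewrite circX natrX -exprMn divff// expr1n circ1. Qed.

Lemma unity_root_half m : unity_root m.+1 ^+ (2 ^ m)%N = -1.
Proof. by rewrite circX natrX exprS mulrCA -exprMn divff// expr1n mulr1 circ_half.
  Qed.

Lemma unity_root_neq0 m : unity_root m != 0.
Proof. exact: circ_neq0. Qed.

Lemma cmod_unity_rootX m k : cmod (unity_root m ^+ k) = 1.
Proof. by rewrite cmodX cmod_circ expr1n. Qed.

Lemma oneN1_neq : (1 : C) != -1.
Proof. by rewrite -subr_eq0 opprK -(natrD _ 1 1) pnatr_eq0. Qed.

(** The order divides [2 ^ m], hence is [2 ^ i]; if [i < m], the power of exponent [2 ^ (m - 1)]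
    would be 1, whereas it is -1. *)
Lemma prim_unity_root m : (2 ^ m).-primitive_root (unity_root m).
Proof.
have [d prd] := prim_order_exists (expn_gt0 2 m) (unity_rootX m).
case/dvdn_pfactor => // i im dE; move: prd; rewrite dE.
move: im; rewrite leq_eqVlt => /predU1P[->//|im] /prim_expr_order wi.
case: m im wi {dE} => // m im wi; have := unity_root_half m.
rewrite (_ : (2 ^ m = 2 ^ i * 2 ^ (m - i))%N); last by rewrite -expnD subnKC.
by rewrite exprM wi expr1n => /eqP; rewrite (negbTE oneN1_neq).
Qed.

Lemma sum_unity_root m k : (k < 2 ^ m)%N ->
  \sum_(j < 2 ^ m) (unity_root m ^- j) ^+ k = (if k == 0%N then (2 ^ m)%:R else 0 :
    C).
Proof.
move=> km; have [->|k0] := eqVneq k 0%N.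
  by rewrite (eq_bigr (fun=> 1)) ?sumr_const ?card_ord// => j _; rewrite expr0.
set y := unity_root m ^- k.
have y1 : y != 1.
  rewrite invr_eq1 -(prim_order_dvd (prim_unity_root m)).
  by rewrite gtnNdvd// lt0n.
have := subrX1 y (2 ^ m); rewrite /y exprVn -exprM mulnC exprM unity_rootX expr1n
  invr1 subrr.
move=> /esym/eqP; rewrite mulf_eq0 subr_eq0 (negbTE y1) /= => /eqP sy.
by rewrite -[RHS]sy; apply: eq_bigr => j _; rewrite !exprVn -!exprM mulnC.
Qed.

(** With [w] the root, [(w ^+ 2) ^+ (2 ^ m) - 1 = -2] factors as [w ^+ 2 - 1] times a sum of [2 ^ m]
    numbers of modulus 1. This bounds the step of the Riemann sums on the circle from below. *)
Lemma unity_root_step m : 8 <= 2 ^+ m.+2 * cmod (unity_root m.+2 - (unity_root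
  m.+2)^-1).
Proof.
set w := unity_root m.+2.
have -> : cmod (w - w^-1) = cmod (w ^+ 2 - 1).
  rewrite -[LHS]mul1r -(cmod_circ (2^-1 ^+ m.+2)) -cmodM mulrBr -/w -/(unity_root _)
    -/w.
  by rewrite mulfV ?unity_root_neq0// expr2.
have : (w ^+ 2) ^+ (2 ^ m)%N - 1 = -2.
  by rewrite -exprM -expnS unity_root_half -opprD -(natrD _ 1 1).
rewrite subrX1 => /(congr1 (@cmod R)); rewrite cmodN cmod_nat cmodM => h.
have : cmod (\sum_(i < 2 ^ m) (w ^+ 2) ^+ i) <= 2 ^+ m.
  apply: (le_trans (ler_cmod_sum _ _ _)).
  rewrite (eq_bigr (fun=> 1)) ?sumr_const ?card_ord ?natrX// => j _.
  by rewrite -exprM cmod_unity_rootX.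
move=> /(ler_wpM2l (cmod_ge0 (w ^+ 2 - 1))); rewrite h.
by rewrite !exprS; lra.
Qed.

End Circle.

(** * Cauchy's formula on a circle *)

Section Cauchy.
Variable R : realType.
Local Notation C := (Cplx R).
Local Notation circ := (@circ R).
Local Notation unity_root := (@unity_root R).
Implicit Types (f g : C -> C) (m k : nat) (z w : C).

Lemma trapsum_sum f (u : R -> C) m x s :
  trapsum f u m x s = \sum_(0 <= j < 2 ^ m)
    trapsum f u 0 (x + j%:R * (s / 2 ^+ m)) (s / 2 ^+ m).
Proof.
elim: m x s => [|m IH] x s; first by rewrite big_nat1 mul0r addr0 expr0 divr1.
rewrite [LHS]/(trapsum f u m x (s / 2) + trapsum f u m (x + s / 2) (s / 2)).
have sE : s / 2 ^+ m.+1 = s / 2 / 2 ^+ m by rewrite exprS invfM mulrA.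
rewrite expnS mul2n -addnn (@big_cat_nat _ _ _ (2 ^ m)) ?leq_addr//= sE -IH.
congr (_ + _); rewrite IH -[X in _ = \sum_(X <= _ < _) _]add0n big_addn addnK.
apply: eq_bigr => j _; congr (trapsum f u 0 _ _).
by rewrite natrD natrX mulrDl [2 ^+ m * _]mulrC divfK ?expf_neq0// -addrA [X in _
  + X]addrC addrA.
Qed.

Lemma trapsum_circ f (r : R) m :
  let v := unity_root m in
  trapsum f (fun t => cplx r * circ t) m 0 1 =
  (v - v^-1) / 2 * \sum_(j < 2 ^ m) f (cplx r * v ^+ j) * (cplx r * v ^+ j).
Proof.
move=> v; pose G j := f (cplx r * v ^+ j) * (cplx r * v ^+ j).
have v0 : v != 0 by exact: unity_root_neq0.
have Gcyc : \sum_(0 <= j < 2 ^ m) G j.+1 = \sum_(0 <= j < 2 ^ m) G j.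
  have := expn_gt0 2 m; case E : (2 ^ m)%N => [//|N] _.
  rewrite big_nat_recr//= [RHS]big_nat_recl//= addrC; congr (_ + _).
  by rewrite /G -E unity_rootX expr0.
rewrite trapsum_sum -(big_mkord xpredT G) /=.
(* The step from [u_j] to [u_(j+1) = v u_j] equals both [(v - 1) u_j] and [(1 - v^-1) u_(j+1)]; each
   endpoint value is paired with the form containing its own node, and the sums of [G j] and
   [G j.+1] agree cyclically. *)
transitivity (\sum_(0 <= j < 2 ^ m) ((v - 1) / 2 * G j + (1 - v^-1) / 2 * G j.+1)).
  apply: eq_big_nat => j _ /=.
  have uE i : circ (i%:R * (1 / 2 ^+ m)) = v ^+ i by rewrite circX mul1r -exprVn.
  have jS (h : R) : j%:R * h + h = j.+1%:R * h by rewrite -addn1 natrD mulrDl mul1r.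
  rewrite /= add0r jS !uE /G exprS.
  by field.
rewrite big_split /= -!mulr_sumr Gcyc -mulrDl; congr (_ * _).
by field.
Qed.

Definition divdiff f z w := (f w - f z) / (w - z).

(** A discrete form of the vanishing of the integral of [(f w - f z) / (w - z)] over the circle.
    Goursat's theorem on an annular region compares that circle with a small one around [z], where
    the quotient is bounded. *)
Lemma divdiff_mean_cvg0 f (r : R) z (e : R) : entire f -> cmod z < r -> 0 < e ->
  exists N, forall m, (N <= m)%N ->
    cmod ((2 ^+ m)^-1 * \sum_(j < 2 ^ m)
      divdiff f z (cplx r * unity_root m ^+ j) * (cplx r * unity_root m ^+ j)) <= e.
Proof.
move=> ef zr e0; have z0 := cmod_ge0 z; have r0 : 0 < r by lra.
have [d fd] := (entireP f).1 ef z; have [r1 r10 fr] := fd _ ltr01.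
pose B := cmod d + 1; have B0 : 0 < B by rewrite /B; have := cmod_ge0 d; lra.
pose L : R := 4 * pi; have L0 : 0 < L by rewrite mulr_gt0// pi_gt0.
(* The first bound keeps the small circle where the quotient is at most [B]; the second makes the
   sum along it at most [e / 2]. *)
pose s := Num.min (r1 / 2) (e / (2 * (B * L))).
have BL0 : 0 < 2 * (B * L) by have := mulr_gt0 B0 L0; lra.
have s0 : 0 < s by rewrite lt_min !divr_gt0.
have gB t : cmod (divdiff f z (z + cplx s * circ t)) <= B.
  have sz : cmod (cplx s * circ t) = s
    by rewrite cmodM cmod_circ mulr1 cmod_cplx gtr0_norm.
  rewrite /divdiff addrAC subrr add0r cmodM cmodV sz ler_pdivrMr//.
  have sr1 : s < r1.
    apply: le_lt_trans (_ : r1 / 2 < _); last by lra.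
    by rewrite ge_min lexx.
  have := fr (z + cplx s * circ t); rewrite addrAC subrr add0r sz mul1r => /(_ sr1) h.
  have -> : f (z + cplx s * circ t) - f z =
    (f (z + cplx s * circ t) - f z - d * (cplx s * circ t))
      + d * (cplx s * circ t) by ring.
  by apply: (le_trans (ler_cmodD _ _)); rewrite cmodM sz /B; lra.
(* A linear homotopy from the circle of radius [s] about [z] to that of radius [r] about 0. It
   avoids [z], since its distance to [z] is at least [(1 - x) * s + x * (r - cmod z)]. *)
pose gam (x t : R) : C := cplx (1 - x) * (z + cplx s * circ t)
  + cplx x * (cplx r * circ t).
have gamz x t : 0 <= x <= 1 -> 0 < cmod (gam x t - z).
  move=> x01; have -> : gam x t - z
    = cplx ((1 - x) * s + x * r) * circ t - cplx x * z.
    by rewrite /gam [cplx (_ * s + _)]cplxD !cplxM cplxB; ring.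
  apply: lt_le_trans (_ : cmod (cplx ((1 - x) * s
    + x * r) * circ t) - cmod (cplx x * z) <= _).
    have x1s : 0 <= (1 - x) * s by rewrite mulr_ge0; lra.
    have xr : 0 <= x * (r - cmod z) by rewrite mulr_ge0; lra.
    have xz : 0 <= x * cmod z by rewrite mulr_ge0; lra.
    rewrite !cmodM cmod_circ !cmod_cplx mulr1 !ger0_norm; [|lra|lra].
    have [x2|x2] := leP x (1 / 2); first by have : s / 2 <= (1 - x) * s; [nra|lra].
    by have : (r - cmod z) / 2 <= x * (r - cmod z); [nra|lra].
  by rewrite lerBlDr -{1}(subrK (cplx x * z) (cplx ((1 - x) * s
    + x * r) * circ t)) ler_cmodD.
pose K := (r + cmod z + s) * (1 + L).
have K0 : 0 < K by rewrite mulr_gt0//; lra.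
have gamK x y x' y' : 0 <= x <= 1 -> 0 <= y <= 1 -> 0 <= x' <= 1 -> 0 <= y' <= 1 ->
    cmod (gam x' y' - gam x y) <= K * (`|x' - x| + `|y' - y|).
  move=> x01 y01 x01' y01'.
  have -> : gam x' y' - gam x y = cplx (x' - x) * (cplx r * circ y' - z - cplx s *
    circ y')
     + cplx ((1 - x) * s + x * r) * (circ y' - circ y).
    by rewrite /gam [cplx (_ * s + _)]cplxD !cplxM !cplxB; ring.
  apply: (le_trans (ler_cmodD _ _)); rewrite [leRHS]mulrDr; apply: lerD.
    rewrite cmodM cmod_cplx mulrC ler_wpM2r//.
    apply: (le_trans (ler_cmodB _ _));
      rewrite cmodM cmod_circ cmod_cplx gtr0_norm// mulr1.
    have := ler_cmodB (cplx r * circ y') z.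
    rewrite cmodM cmod_circ cmod_cplx gtr0_norm// mulr1 /K; nra.
  rewrite cmodM cmod_cplx.
  have h := circ_lipschitz y' y; rewrite -/L in h.
  apply: le_trans (_ : (r + cmod z + s) * (L * `|y' - y|) <= _).
    by apply: ler_pM; rewrite ?cmod_ge0// ger0_norm; nra.
  by rewrite mulrA ler_wpM2r// /K ler_wpM2l//; lra.
have gdiff x t : 0 <= x <= 1 -> 0 <= t <= 1 -> cdiff (divdiff f z) (gam x t).
  move=> x01 _; apply: cdiff_divided_difference => //.
  by have := gamz x t x01; rewrite cmod_gt0 subr_eq0.
have [N hN] := discrete_goursat K0 gamK gdiff (divr_gt0 e0 (ltr0n _ 2)).
exists (maxn N 2) => m; rewrite geq_max => /andP[/hN bdm m2].
set S := \sum_(j < _) _.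
have gam1 : gam 1 = fun t => cplx r * circ t.
  by apply/funext => t; rewrite /gam subrr /cplx !(rmorph0,
    rmorph1) mul0r add0r mul1r.
have gam0 : gam 0 = fun t => z + cplx s * circ t.
  by apply/funext => t; rewrite /gam subr0 /cplx !(rmorph0,
    rmorph1) mul0r addr0 mul1r.
(* The edges [t = 0] and [t = 1] are the same path and cancel in [bdsum], leaving the difference of
   the two circles. *)
have gamp : gam^~ 1 = gam^~ 0 by apply/funext => x; rewrite /gam circ0 circ1.
have T0 : cmod (trapsum (divdiff f z) (gam 0) m 0 1) <= e / 2.
  apply: le_trans (_ : B * (s * L) * 1 <= _).
    apply: ler_trapsum => // [t _|t t' _ tt _]; first by rewrite gam0.
    rewrite gam0 opprD addrACA subrr add0r -mulrBr cmodM cmod_cplx gtr0_norm//.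
    rewrite -mulrA ler_wpM2l ?(ltW s0)//.
    by apply: (le_trans (circ_lipschitz _ _)); rewrite ger0_norm ?subr_ge0.
  rewrite mulr1 mulrCA.
  have : s <= e / (2 * (B * L)) by rewrite ge_min lexx orbT.
  rewrite ler_pdivlMr//; lra.
have T1 : cmod (trapsum (divdiff f z) (gam 1) m 0 1) <= e.
  have bdE : bdsum (divdiff f z) gam m 0 0 1 =
      trapsum (divdiff f z) (gam 1) m 0 1 - trapsum (divdiff f z) (gam 0) m 0 1.
    by rewrite /bdsum add0r gamp; ring.
  rewrite bdE in bdm.
  rewrite -(subrK (trapsum (divdiff f z) (gam 0) m 0 1) (trapsum _ _ _ _ _)).
  by apply: (le_trans (ler_cmodD _ _)); lra.
move: T1; rewrite gam1 trapsum_circ -/S cmodM cmodM cmodV cmod_nat.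
(* For levels at least 2, [unity_root_step] shows that [(v - v^-1) / 2] has modulus at least
   [4 / 2 ^ m], so the bound on the trapezoidal sum passes to the mean. *)
case: m m2 S {bdm T0} => [|[|m]] // _ S.
have := unity_root_step R m; set a := cmod (_ - _); set b := 2 ^+ _ => ab.
have b0 : 0 < b by rewrite exprn_gt0.
have cb : cmod (2 ^+ m.+2 : C)^-1 = b^-1 by rewrite cmodV cmodX cmod_nat.
move=> aS; rewrite cmodM cb mulrC ler_pdivrMr//.
have := cmod_ge0 S; nra.
Qed.

End Cauchy.

(** * Interpolation at roots of unity *)

Section Interpolation.
Variable R : realType.
Local Notation C := (Cplx R).
Local Notation unity_root := (@unity_root R).
Implicit Types (f g : C -> C) (m k n : nat) (z w : C) (r e : R).

(** A discrete Fourier coefficient on the circle of radius [r], approximating [r ^ k] times the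
    Taylor coefficient of order [k]. *)
Definition dft f r m k : C := (2 ^+ m)^-1 *
  \sum_(j < 2 ^ m) f (cplx r * unity_root m ^+ j) * (unity_root m ^- j) ^+ k.

Definition interp f r m z := \sum_(k < 2 ^ m) dft f r m k * (z / cplx r) ^+ k.

(** A discrete Cauchy formula: the finite geometric sum of the [(x * v ^- j) ^+ k] is the kernel
    [w_j / (w_j - z)] times [1 - x ^+ N], and orthogonality of the roots of unity gives this kernel
    mean 1. *)
Lemma interpE f r m z : cmod z < r -> interp f r m z - f z =
  (1 - (z / cplx r) ^+ (2 ^ m)) * ((2 ^+ m)^-1 * \sum_(j < 2 ^ m)
      divdiff f z (cplx r * unity_root m ^+ j) * (cplx r * unity_root m ^+ j)).
Proof.
move=> zr; have r0 : 0 < r by apply: le_lt_trans zr; exact: cmod_ge0.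
pose N := (2 ^ m)%N; pose v := unity_root m; pose x := z / cplx r.
have rc0 : cplx r != 0 by rewrite -cmod_eq0 cmod_cplx gtr0_norm// gt_eqF.
have v0 j : v ^+ j != 0 by rewrite expf_neq0// unity_root_neq0.
have N0 : 2 ^+ m != 0 :> C by rewrite expf_neq0// pnatr_eq0.
have w0 j : cplx r * v ^+ j != 0 by rewrite mulf_neq0.
have wz j : cplx r * v ^+ j - z != 0.
  rewrite subr_eq0; apply: contraTneq zr => <-.
  by rewrite cmodM cmod_unity_rootX mulr1 cmod_cplx gtr0_norm// ltxx.
have geo j : (1 - x ^+ N) * (cplx r * v ^+ j) / (cplx r * v ^+ j - z) =
    \sum_(k < N) x ^+ k * (v ^- j) ^+ k.
  have xv : x * v ^- j = z / (cplx r * v ^+ j) by rewrite /x invfM mulrA.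
  transitivity (\sum_(k < N) (x * v ^- j) ^+ k); last first.
    by apply: eq_bigr => k _; rewrite exprMn.
  have := subrX1 (x * v ^- j) N.
  rewrite exprMn exprVn -exprM mulnC exprM unity_rootX expr1n invr1 mulr1 => h.
  have -> : 1 - x ^+ N = - (x ^+ N - 1) by rewrite opprB.
  rewrite h xv; field.
  by apply/and3P; split; [exact: wz|exact: v0|exact: rc0].
have sum1 : (2 ^+ m)^-1 * \sum_(j < N) \sum_(k < N) x ^+ k * (v ^- j) ^+ k = 1.
  rewrite exchange_big /= (eq_bigr (fun k : 'I_N =>
    x ^+ k * (if k == 0%N :> nat then N%:R else 0))).
    have : (0 < N)%N by rewrite expn_gt0.
    case E : N => [//|N'] _; rewrite big_ord_recl /= expr0 mul1r big1 ?addr0.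
      by rewrite -E natrX mulVf.
    by move=> k _; rewrite /= mulr0.
  by move=> k _; rewrite -mulr_sumr sum_unity_root// -/N.
rewrite mulrCA mulr_sumr (eq_bigr (fun j : 'I_N => \sum_(k < N)
   (f (cplx r * v ^+ j) * (v ^- j) ^+ k * x ^+ k - f z * (x ^+ k * (v ^- j) ^+ k))));
     last first.
  move=> j _; rewrite /divdiff -/v -/x -/N.
  transitivity ((f (cplx r * v ^+ j) - f z) * \sum_(k < N) x ^+ k * (v ^- j) ^+ k).
    by rewrite -geo; field; exact: wz.
  by rewrite mulr_sumr; apply: eq_bigr => k _; ring.
rewrite (eq_bigr (fun j : 'I_N => \sum_(k < N) f (cplx r * v ^+ j) * (v ^- j) ^+ k *
  x ^+ k
  - f z * \sum_(k < N) x ^+ k * (v ^- j) ^+ k)); last first.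
  by move=> j _; rewrite sumrB mulr_sumr.
rewrite sumrB -mulr_sumr mulrBr mulrCA sum1 mulr1; congr (_ - _).
rewrite exchange_big /= mulr_sumr; apply: eq_bigr => k _.
by rewrite /dft -mulr_suml mulrA.
Qed.

Lemma interp_cvg f r z e : entire f -> cmod z < r -> 0 < e ->
  exists N, forall m, (N <= m)%N -> cmod (interp f r m z - f z) <= e.
Proof.
move=> ef zr e0; have r0 : 0 < r by apply: le_lt_trans zr; exact: cmod_ge0.
have e20 : 0 < e / 2 by lra.
have [N hN] := divdiff_mean_cvg0 ef zr e20.
exists N => m /hN h; rewrite interpE// cmodM.
set c := cmod (1 - _); have : c <= 2.
  apply: (le_trans (ler_cmodB _ _)); rewrite cmod1.
  have : cmod ((z / cplx r) ^+ (2 ^ m)) <= 1; last by lra.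
  rewrite cmodX exprn_ile1 ?cmod_ge0// cmodM cmodV cmod_cplx gtr0_norm//.
  by rewrite ler_pdivrMr// mul1r ltW.
have := cmod_ge0 (1 - (z / cplx r) ^+ (2 ^ m)); rewrite -/c.
have := cmod_ge0 ((2 ^+ m)^-1 * \sum_(j < 2 ^ m) divdiff f z (cplx r * unity_root m
  ^+ j) * (cplx r * unity_root m ^+ j)).
move: h; set d := cmod _; nra.
Qed.

Lemma dftB f g r m k : dft (fun w => f w - g w) r m k = dft f r m k - dft g r m k.
Proof.
rewrite /dft -mulrBr -sumrB; congr (_ * _).
by apply: eq_bigr => j _; rewrite mulrBl.
Qed.

Lemma interpB f g r m z : interp (fun w =>
  f w - g w) r m z = interp f r m z - interp g r m z.
Proof. by rewrite /interp -sumrB; apply: eq_bigr => k _; rewrite dftB mulrBl. Qed.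

Lemma ler_dft f r m k (B : R) : 0 <= r ->
  (forall w, cmod w <= r -> cmod (f w) <= B) -> cmod (dft f r m k) <= B.
Proof.
move=> r0 fB; rewrite cmodM cmodV cmodX cmod_nat ler_pdivrMl ?exprn_gt0//.
apply: (le_trans (ler_cmod_sum _ _ _)).
rewrite -natrX -[X in X%:R]card_ord mulr_natl -sumr_const.
apply: ler_sum => j _; rewrite cmodM -exprVn -!exprM cmodX cmodV cmod_circ invr1
  expr1n mulr1.
by apply: fB; rewrite cmodM cmod_unity_rootX mulr1 cmod_cplx ger0_norm.
Qed.

Lemma ler_sum_halfX n : \sum_(k < n) (2^-1 : R) ^+ k <= 2.
Proof.
have -> : \sum_(k < n) (2^-1 : R) ^+ k = 2 - 2 * 2^-1 ^+ n.
  elim: n => [|n IH]; first by rewrite big_ord0 expr0; ring.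
  by rewrite big_ord_recr /= IH exprS; field.
by have : 0 <= (2^-1 : R) ^+ n; [rewrite exprn_ge0|lra].
Qed.

Lemma ler_sum_half_mulX n : \sum_(k < n) k%:R * (2^-1 : R) ^+ k <= 2.
Proof.
have -> : \sum_(k < n) k%:R * (2^-1 : R) ^+ k = 2 - n.+1%:R * 2 * 2^-1 ^+ n.
  elim: n => [|n IH]; first by rewrite big_ord0 expr0; ring.
  by rewrite big_ord_recr /= IH exprS -addn1 -[n.+2]addn2 !natrD; field.
have : 0 <= (2^-1 : R) ^+ n by rewrite exprn_ge0.
by have : 0 <= n.+1%:R :> R; [rewrite ler0n|nra].
Qed.

Lemma ler_dist_exp (a b : C) k : cmod a <= 2^-1 -> cmod b <= 2^-1 ->
  cmod (a ^+ k - b ^+ k) <= 2 * k%:R * 2^-1 ^+ k * cmod (a - b).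
Proof.
move=> ha hb; elim: k => [|k IH]; first by rewrite subrr cmod0 !mulr0 !mul0r.
have -> : a ^+ k.+1 - b ^+ k.+1 = a * (a ^+ k - b ^+ k) + b ^+ k * (a - b).
  by rewrite !exprS; ring.
apply: (le_trans (ler_cmodD _ _)); rewrite !cmodM cmodX.
have hbk : cmod b ^+ k <= 2^-1 ^+ k by rewrite lerXn2r ?nnegrE ?cmod_ge0.
have := ler_wpM2r (cmod_ge0 (a - b)) hbk.
have := ler_wpM2l (cmod_ge0 a) IH.
have ak : cmod a * (2 * k%:R * 2^-1 ^+ k * cmod (a - b))
  <= 2^-1 * (2 * k%:R * 2^-1 ^+ k * cmod (a - b)).
  by rewrite ler_wpM2r// !mulr_ge0 ?exprn_ge0 ?cmod_ge0.
move=> h1 h2; rewrite exprS -addn1 natrD.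
apply: (le_trans (lerD (le_trans h1 ak) h2)).
by rewrite le_eqVlt; apply/orP; left; apply/eqP; field.
Qed.

(** The constant is independent of [m]; this equicontinuity turns pointwise convergence of the
    interpolants into uniform convergence on compact sets. *)
Lemma interp_lipschitz f r m z w (B : R) : 0 < r ->
  (forall u, cmod u <= r -> cmod (f u) <= B) ->
  cmod z <= r / 2 -> cmod w <= r / 2 ->
  cmod (interp f r m z - interp f r m w) <= 4 * B / r * cmod (z - w).
Proof.
move=> r0 fB zr wr.
have B0 : 0 <= B.
  by apply: le_trans (fB 0 _); rewrite ?cmod_ge0// cmod0 ltW.
have cr u : cmod (u / cplx r) = cmod u / r.
  by rewrite cmodM cmodV cmod_cplx gtr0_norm.
rewrite /interp -sumrB; apply: (le_trans (ler_cmod_sum _ _ _)).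
apply: le_trans (_ : \sum_(k < 2 ^ m) (2 * B * (cmod (z - w) / r)) * (k%:R * 2^-1 ^+
  k) <= _).
  apply: ler_sum => k _; rewrite -mulrBr cmodM.
  have := @ler_dist_exp (z / cplx r) (w / cplx r) k.
  rewrite !cr -mulrBl cr !ler_pdivrMr// [2^-1 * r]mulrC => /(_ zr wr) h.
  have -> : 2 * B * (cmod (z - w) / r) * (k%:R * 2^-1 ^+ k) =
     B * (2 * k%:R * 2^-1 ^+ k * (cmod (z - w) / r)) by ring.
  by apply: ler_pM; rewrite ?cmod_ge0// ler_dft// ltW.
rewrite -mulr_sumr; have := ler_sum_half_mulX (2 ^ m).
have : 0 <= 2 * B * (cmod (z - w) / r).
  by apply: mulr_ge0; [apply: mulr_ge0|rewrite divr_ge0 ?cmod_ge0 ?ltW].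
move=> h1 h2; apply: (le_trans (ler_wpM2l h1 h2)).
by rewrite le_eqVlt; apply/orP; left; apply/eqP; ring.
Qed.

(** Stability of interpolation, uniform in [m]: the coefficients are at most [B] and the powers are
    dominated by a geometric series of ratio 1/2. *)
Lemma ler_interp f r m z (B : R) : 0 < r ->
  (forall u, cmod u <= r -> cmod (f u) <= B) ->
  cmod z <= r / 2 -> cmod (interp f r m z) <= 2 * B.
Proof.
move=> r0 fB zr.
have B0 : 0 <= B.
  by apply: le_trans (fB 0 _); rewrite ?cmod_ge0// cmod0 ltW.
apply: (le_trans (ler_cmod_sum _ _ _)).
apply: le_trans (_ : \sum_(k < 2 ^ m) B * 2^-1 ^+ k <= _); last first.
  by rewrite -mulr_sumr mulrC ler_wpM2r// ler_sum_halfX.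
apply: ler_sum => k _; rewrite cmodM; apply: ler_pM; rewrite ?cmod_ge0//.
  by rewrite ler_dft// ltW.
rewrite cmodX lerXn2r ?nnegrE ?cmod_ge0// cmodM cmodV cmod_cplx gtr0_norm//.
by rewrite ler_pdivrMr// mulrC.
Qed.

(** The terms of order at least 2 are at most [B * cmod h ^+ 2] times a geometric series. The bound
    is uniform in [m], so it survives a passage to the limit. *)
Lemma interp_taylor2 f m h (B : R) : (0 < m)%N ->
  (forall u, cmod u <= 1 -> cmod (f u) <= B) -> cmod h <= 2^-1 ->
  cmod (interp f 1 m h - interp f 1 m 0 - dft f 1 m 1 * h) <= 2 * B * cmod h ^+ 2.
Proof.
move=> m0 fB hh.
have B0 : 0 <= B.
  by apply: le_trans (fB 0 _); rewrite ?cmod_ge0// cmod0 ltW.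
(* At least two coefficients exist, so the constant and linear terms can be split off. *)
have /subnKC : (2 <= 2 ^ m)%N by rewrite -{1}[2%N]expn1 leq_pexp2l.
rewrite /interp; set N := (2 ^ m - 2)%N => <-.
have c1 : cplx (1 : R) = 1 by exact: rmorph1.
have -> : \sum_(k < 2 + N) dft f 1 m k * (0 / cplx 1) ^+ k = dft f 1 m 0.
  rewrite big_ord_recl /= expr0 mulr1 big1 ?addr0// => k _.
  by rewrite exprS !mul0r mulr0.
rewrite c1 !big_ord_recl /= expr0 mulr1.
set S := \sum_(i < N) _; rewrite (_ : _ - _ = S); last first.
  by rewrite /bump /= expr1 divr1; ring.
apply: (le_trans (ler_cmod_sum _ _ _)).
apply: le_trans (_ : \sum_(k < N) B * cmod h ^+ 2 * 2^-1 ^+ k <= _); last first.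
  rewrite -mulr_sumr mulrC -mulrA ler_wpM2r ?ler_sum_halfX//.
  by rewrite mulr_ge0// exprn_ge0// cmod_ge0.
apply: ler_sum => k _; rewrite divr1 !exprS cmodM -!mulrA; apply: ler_pM;
  rewrite ?cmod_ge0//.
  exact: ler_dft.
rewrite !cmodM !ler_wpM2l ?cmod_ge0// mul1r cmodX lerXn2r ?nnegrE ?cmod_ge0//.
Qed.

End Interpolation.

(** * Locally uniform limits of entire functions, and polynomial approximation *)

Section Closure.
Variable R : realType.
Local Notation C := (Cplx R).
Implicit Types (f g : C -> C) (m k n : nat) (z w : C) (r e : R).

Definition entire_approx f := forall r e, 0 < e ->
  exists2 g, entire g & forall z, cmod z <= r -> cmod (f z - g z) <= e.

(** Interpolation is linear and [ler_interp] controls it by the supremum alone, so convergence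
    transfers from an entire [g] close to [f]. The errors are [2 * (e / 4)], [e / 4] and [e / 4]. *)
Lemma entire_approx_interp_cvg f z e : entire_approx f -> cmod z <= 2^-1 -> 0 < e ->
  exists N, forall m, (N <= m)%N -> cmod (interp f 1 m z - f z) <= e.
Proof.
move=> fa zr e0; have e4 : 0 < e / 4 by lra.
have [g eg fg] := fa 1 _ e4.
have z1 : cmod z < 1 by lra.
have [N hN] := interp_cvg eg z1 e4; exists N => m /hN h.
have -> : interp f 1 m z - f z =
    interp (fun w => f w - g w) 1 m z + (interp g 1 m z - g z) - (f z - g z).
  by rewrite interpB; ring.
apply: (le_trans (ler_cmodB _ _)).
have := ler_cmodD (interp (fun w => f w - g w) 1 m z) (interp g 1 m z - g z).
have zh : cmod z <= 1 / 2 by lra.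
have := ler_interp m ltr01 fg zh.
have := fg z (ltW z1); lra.
Qed.

(** The linear coefficients of the interpolants are bounded. Any cluster point [d] of them is the
    derivative, because [interp_taylor2] gives [cmod (f h - f 0 - d * h) <= 2 * B * cmod h ^+ 2] in
    the limit. *)
Lemma entire_approx_cdiff0 f : entire_approx f -> cdiff f 0.
Proof.
move=> fa; have [g eg fg] := fa 1 1 ltr01.
have [B0 B00 gB] := entire_bounded 1 eg; pose B := B0 + 1.
have fB w : cmod w <= 1 -> cmod (f w) <= B.
  move=> w1; have := fg w w1; have := gB w w1; have := ler_cmodD (f w - g w) (g w).
  by rewrite subrK /B; lra.
have [K cK BK] := closed_ball_compact B.
pose b := fun m => dft f 1 m 1.
have bB m : cmod (b m) <= B by exact: ler_dft.
have [|d [_ bd]] := cK (b @ \oo) _; first by exists 0 => //= m _; apply: BK.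
exists d => e e0.
have B20 : 0 < 2 * B by rewrite /B; lra.
exists (Num.min 2^-1 (e / (2 * B)));
  first by rewrite lt_min invr_gt0 ltr0n /= divr_gt0.
move=> h; rewrite subr0 lt_min ltr_pdivlMr// => /andP[h2 hB].
apply: le_trans (_ : 2 * B * cmod h ^+ 2 <= _); last first.
  by have := cmod_ge0 h; nra.
apply/ler_addgt0Pr => eps eps0.
have e30 : 0 < eps / 3 by lra.
have [N1 hN1] := entire_approx_interp_cvg fa (ltW h2) e30.
have z2 : cmod (0 : C) <= 2^-1 by rewrite cmod0 invr_ge0.
have [N2 hN2] := entire_approx_interp_cvg fa z2 e30.
have [] := bd (b @` [set m | (maxn 1 (maxn N1 N2)
  <= m)%N]) [set w | cmod (w - d) < eps / 3].
- by exists (maxn 1 (maxn N1 N2)) => // m /= hm; exists m.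
- exact: nbhs_cmod_lt.
move=> _ [[m /= + <-] bmd]; rewrite !geq_max => /and3P[m0 /hN1 h1 /hN2 h0].
have := interp_taylor2 m0 fB (ltW h2); rewrite -/(b m).
set E := _ - _ => hE.
have -> : f h - f 0 - d * h = E - (interp f 1 m h - f h) + (interp f 1 m 0 - f 0)
  + (b m - d) * h.
  by rewrite /E; ring.
have t1 := ler_cmodD (E - (interp f 1 m h - f h)
  + (interp f 1 m 0 - f 0)) ((b m - d) * h).
have t2 := ler_cmodD (E - (interp f 1 m h - f h)) (interp f 1 m 0 - f 0).
have t3 := ler_cmodB E (interp f 1 m h - f h).
have t4 : cmod ((b m - d) * h) <= eps / 3.
  by rewrite cmodM; move: bmd h2; have := cmod_ge0 (b m - d); have := cmod_ge0 h;
    rewrite /=; nra.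
lra.
Qed.

Lemma entire_limit f : entire_approx f -> entire f.
Proof.
move=> fa; apply/entireP => z.
have [d fd] : cdiff (fun w => f (w + z)) 0.
  apply: entire_approx_cdiff0 => r e e0.
  have [g eg fg] := fa (r + cmod z) e e0.
  exists (fun w => g (w + z)); first exact: entire_translate.
  by move=> w wr; apply: fg; apply: (le_trans (ler_cmodD _ _)); rewrite lerD2r.
exists d => e /fd[r r0 hr]; exists r => // w wz.
by have := hr (w - z); rewrite !subr0 subrK add0r; apply.
Qed.

(** The interpolants are polynomials that converge pointwise and are equi-Lipschitz; compactness
    makes one level [N] work on the whole disc. *)
Lemma entire_poly_approx f r e : entire f -> 0 < e ->
  exists p : {poly C}, forall z, cmod z <= r -> cmod (f z - p.[z]) <= e.
Proof.
move=> ef e0; have [K cK rK] := closed_ball_compact r.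
have [r' Kr] := compact_cmod_bounded cK.
(* Points within 1 of [K] stay in the disc of radius [s / 2], where [interp_lipschitz] applies. *)
pose s := 2 * (`|r'| + 1); have s0 : 0 < s by rewrite /s; have := normr_ge0 r'; lra.
have [B B0 fB] := entire_bounded s ef.
suff [N _ hN] : \forall m \near \oo, K `<=` (fun z =>
  cmod (f z - interp f s m z) <= e).
  exists (\poly_(k < 2 ^ N) (dft f s N k / cplx s ^+ k)) => z /rK /(hN N (leqnn N)).
  rewrite horner_poly /interp; congr (cmod (_ - _) <= _); apply: eq_bigr => k _.
  by rewrite expr_div_n; field; rewrite expf_neq0// -cmod_eq0 cmod_cplx normr_eq0
    gt_eqF.
apply: (compact_near_coveringP K).1 cK _ _ _ _ _ => z Kz.
have e30 : 0 < e / 3 by lra.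
have zs : cmod z <= `|r'| by rewrite (le_trans (Kr _ Kz))// ler_norm.
have zs' : cmod z < s by rewrite /s; have := normr_ge0 r'; lra.
have [N hN] := interp_cvg ef zs' e30.
have /continuous_cmodP/(_ _ e30)[d d0 dE] := entire_continuous ef (x := z).
pose q := Num.min (Num.min d 1) (e / 3 / (4 * B / s)).
have q0 : 0 < q by rewrite !lt_min d0 ltr01 /= !divr_gt0// mulr_gt0.
exists ([set w | cmod (w - z) < q], [set m | (N <= m)%N]) => /=.
  by split; [exact: nbhs_cmod_lt|exists N].
case=> w m /= []; rewrite !lt_min => /andP[/andP[wd w1] wB] Nm.
have ws : cmod w <= s / 2.
  have := ler_cmodD (w - z) z; rewrite subrK /s; lra.
have := interp_lipschitz m s0 fB ws (_ : cmod z <= s / 2).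
rewrite /s => /(_ ltac:(lra)); rewrite -/s => lip.
have {}lip : cmod (interp f s m w - interp f s m z) <= e / 3.
  apply: (le_trans lip); move: wB; rewrite ltr_pdivlMr;
    last by rewrite divr_gt0// mulr_gt0.
  by rewrite mulrC => /ltW.
have -> : f w - interp f s m w = (f w - f z) - (interp f s m z - f z)
   - (interp f s m w - interp f s m z) by ring.
have t1 := ler_cmodB ((f w - f z) - (interp f s m z - f z)) (interp f s m w - interp
  f s m z).
have t2 := ler_cmodB (f w - f z) (interp f s m z - f z).
have := hN m Nm; have := dE w wd; lra.
Qed.

End Closure.

(** * Approximation on separated discs *)

Section Runge.
Variable R : realType.
Local Notation C := (Cplx R).
Implicit Types (f g h : C -> C) (n : nat) (z w : C) (r e : R).

(** The cubic fixing 0 and 1 with zero derivative at both; it commutes with [v |-> 1 - v], which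
    exchanges the two fixed points. *)
Definition smoothstep (v : C) : C := v ^+ 2 * (3 - 2 * v).

Lemma smoothstep_near0 (v : C) : cmod v <= 1 / 10 -> cmod (smoothstep v)
  <= cmod v / 2.
Proof.
move=> v10; rewrite /smoothstep cmodM cmodX.
have h : cmod (3 - 2 * v) <= 4.
  apply: (le_trans (ler_cmodB _ _)); rewrite cmodM !cmod_nat; lra.
have v0 := cmod_ge0 v; have := ler_wpM2l (mulr_ge0 v0 v0) h.
have := ler_wpM2l v0 v10; rewrite expr2; lra.
Qed.

Lemma smoothstep_near1 (v : C) : cmod (v - 1) <= 1 / 10 ->
  cmod (smoothstep v - 1) <= cmod (v - 1) / 2.
Proof.
rewrite cmodB => /smoothstep_near0.
rewrite (_ : smoothstep (1 - v) = 1 - smoothstep v); last by rewrite /smoothstep;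
  ring.
by rewrite (cmodB 1 (smoothstep v)).
Qed.

Lemma iter_smoothstep_near0 n (v : C) : cmod v <= 1 / 10 ->
  cmod (iter n smoothstep v) <= 2^-1 ^+ n / 10.
Proof.
move=> v10; elim: n => [|n IH]; first by rewrite expr0.
have n1 : (2^-1 : R) ^+ n <= 1 by rewrite exprn_ile1// invf_le1// ler1n.
have := smoothstep_near0 (v := iter n smoothstep v); rewrite -iterS exprS => h.
have {}h := h ltac:(lra); lra.
Qed.

Lemma iter_smoothstep_near1 n (v : C) : cmod (v - 1) <= 1 / 10 ->
  cmod (iter n smoothstep v - 1) <= 2^-1 ^+ n / 10.
Proof.
move=> v10; elim: n => [|n IH]; first by rewrite expr0.
have n1 : (2^-1 : R) ^+ n <= 1 by rewrite exprn_ile1// invf_le1// ler1n.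
have := smoothstep_near1 (v := iter n smoothstep v); rewrite -iterS exprS => h.
have {}h := h ltac:(lra); lra.
Qed.

Lemma entire_iter_smoothstep n f : entire f -> entire (fun z =>
  iter n smoothstep (f z)).
Proof.
move=> ef; elim: n => [//|n IH] /=.
apply: (entireM (entireM IH IH)).
exact: (entireB (@entire_cst R 3) (entireM (@entire_cst R 2) IH)).
Qed.

(* The rational function (w - b) / (z - b), with b slightly farther from 0
   than w on the same ray, already is a rough peak at w; on the disc in
   question its geometric expansion converges, and iterating smoothstep, which
   contracts towards 0 and 1, sharpens the truncated expansion. *)
Lemma peak_function (k : R) w e : 0 < k -> w != 0 -> 0 < e -> exists phi,
  [/\ entire phi, forall z, cmod (z - w) <= k -> cmod (phi z - 1) <= e &
    forall z, cmod z <= cmod w + k -> 420 * k <= cmod (z - w) -> cmod (phi z) <= e].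
Proof.
move=> k0 w0 e0; have cw0 : 0 < cmod w by rewrite cmod_gt0.
pose b := w * cplx (1 + 20 * k / cmod w).
have bw : cmod (w - b) = 20 * k.
  rewrite /b cplxD mulrDr -[cplx 1]/(1 : C) mulr1 opprD addrA subrr add0r cmodN cmodM.
  rewrite cmod_cplx gtr0_norm; first by field; rewrite gt_eqF.
  by rewrite !mulr_gt0 ?invr_gt0.
have cb : cmod b = cmod w + 20 * k.
  rewrite /b cmodM cmod_cplx ger0_norm; first by field; rewrite gt_eqF.
  by rewrite addr_ge0// !mulr_ge0 ?invr_ge0 ?ltW.
have b0 : b != 0 by rewrite -cmod_gt0 cb; lra.
clearbody b.
pose q := (cmod w + k) / (cmod w + 20 * k).
have q0 : 0 <= q by rewrite divr_ge0; lra.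
have q1 : q < 1 by rewrite ltr_pdivrMr; lra.
have c100 : 0 < 1 / 100 :> R by lra.
have [n hn] := exists_expr_le q0 q1 c100.
pose p := \poly_(i < n) (- (w - b) / b ^+ i.+1).
have pE z : p.[z] * (z - b) = (w - b) * (1 - (z / b) ^+ n).
  have -> : 1 - (z / b) ^+ n = - ((z / b) ^+ n - 1) by rewrite opprB.
  rewrite subrX1 horner_poly mulr_suml -mulNr mulrA mulr_sumr; apply: eq_bigr => i _;
    rewrite expr_div_n exprS.
  by field; rewrite expf_neq0.
have zb z : cmod z <= cmod w + k -> cmod ((z / b) ^+ n) <= 1 / 100.
  move=> zw; apply: le_trans hn; rewrite cmodX lerXn2r ?nnegrE ?cmod_ge0//.
  by rewrite cmodM cmodV cb ler_pM2r// invr_gt0; lra.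
(* Near [w], [cmod (z - b) >= 19 * k] against an error of at most [k + 20 * k / 100]. Far from [w],
   [cmod (z - b) >= 400 * k] against a numerator of at most [20 * k * (1 + 1 / 100)]. Both quotients
   are below 1/10. *)
have near z : cmod (z - w) <= k -> cmod (p.[z] - 1) <= 1 / 10.
  move=> zw; have zb' : 19 * k <= cmod (z - b).
    have := cmod_dist_triangle z w b; rewrite bw (cmodB w z); lra.
  have zwk : cmod z <= cmod w + k.
    by have := ler_cmodD (z - w) w; rewrite subrK; lra.
  rewrite -(ler_pM2r (x := cmod (z - b))); last by lra.
  rewrite -cmodM (_ : _ * _ = - (z - w) - (w - b) * (z / b) ^+ n); last first.
    by rewrite mulrBl pE; ring.
  apply: (le_trans (ler_cmodB _ _)); rewrite cmodN cmodM bw.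
  by have := zb z zwk; nra.
have far z : cmod z <= cmod w + k -> 420 * k <= cmod (z - w) -> cmod p.[z] <= 1 / 10.
  move=> zw zwk; have zb' : 400 * k <= cmod (z - b).
    have := cmod_dist_triangle b z w; rewrite (cmodB b w) bw; lra.
  rewrite -(ler_pM2r (x := cmod (z - b))); last by lra.
  rewrite -cmodM pE cmodM bw.
  have := ler_cmodB 1 ((z / b) ^+ n); rewrite cmod1.
  have := zb z zw; nra.
have half1 : 2^-1 < 1 :> R by rewrite invf_lt1// ltr1n.
have half0 : 0 <= 2^-1 :> R by rewrite invr_ge0.
have [N hN] := exists_expr_le half0 half1 e0.
have N0 : 0 <= (2^-1 : R) ^+ N by rewrite exprn_ge0.
exists (fun z => iter N smoothstep p.[z]); split.
- by apply: entire_iter_smoothstep; exact: entire_horner.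
- by move=> z /near/(iter_smoothstep_near1 N); lra.
- by move=> z zw /(far z zw)/(iter_smoothstep_near0 N); lra.
Qed.

(* The discs are added in the order of increasing modulus of their centres, so
   that each new one can be reached by peak_function. *)
Lemma runge_discs (k r e : R) g h (ws : seq C) : 0 < k -> 0 < e ->
  entire g -> entire h -> {in ws, forall w, r + 420 * k <= cmod w} ->
  {in ws &, forall v w, v != w -> 421 * k <= cmod (v - w)} -> 0 <= r ->
  exists f, [/\ entire f, forall z, cmod z <= r -> cmod (f z - g z) <= e &
    {in ws, forall w z, cmod (z - w) <= k -> cmod (f z - h (z - w)) <= e}].
Proof.
move=> k0 e0 eg eh rws sep r0.
(* The list is sorted by decreasing modulus, so that the induction adds its head, the outermost
   disc, last. *)
pose le_mod := (fun v w => cmod w <= cmod v) : rel C.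
pose s := sort le_mod (undup ws).
have : {subset s <= ws} by move=> w; rewrite mem_sort mem_undup.
have : {subset ws <= s} by move=> w; rewrite mem_sort mem_undup.
have le_mod_tr : transitive le_mod by move=> a b c /[swap]; exact: le_trans.
have : uniq s by rewrite sort_uniq undup_uniq.
have : sorted le_mod s by apply: sort_sorted => v w; exact: le_total.
move=> srt unq wss; suff: {subset s <= ws} -> exists f, [/\ entire f,
    forall z, cmod z <= r -> cmod (f z - g z) <= e &
    {in s, forall w z, cmod (z - w) <= k -> cmod (f z - h (z - w)) <= e}].
  by move=> /[apply] -[f [ef fg fh]]; exists f; split=> // w /wss; exact: fh.
elim: s srt unq e e0 {wss} => [|w s IH] srt unq e e0 sws.
  by exists g; split=> // z _; rewrite subrr cmod0 ltW.
have e20 : 0 < e / 2 by lra.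
move: srt; rewrite /= (path_sortedE le_mod_tr) => /andP[/allP smin srt].
move: unq => /= /andP[wNs unq].
have [|f [ef fg fh]] := IH srt unq (e / 2) e20.
  by move=> v vs; apply: sws; rewrite inE vs orbT.
have wws : w \in ws by apply: sws; rewrite mem_head.
have rw := rws _ wws.
have ehw : entire (fun z => h (z - w)) by exact: entire_translate.
have [B B0 hB] := entire_bounded (cmod w + k) (entireB ehw ef).
have w0 : w != 0 by rewrite -cmod_gt0; lra.
have [phi [ephi phi1 phi0]] := peak_function k0 w0 (divr_gt0 e20 B0).
(* Where [phi] is near 1 the new function is near [h (z - w)]; where it is near 0 it stays near [f].
   The base disc and the earlier discs lie at distance at least [420 * k] from [w] and inside the
   disc of radius [cmod w + k], on which [B] bounds the correction. *)
exists (fun z => f z + phi z * (h (z - w) - f z)); split.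
- exact: (entireD ef (entireM ephi (entireB ehw ef))).
- move=> z zr; rewrite (_ : _ - _ = (f z - g z) + phi z * (h (z - w) - f z));
  last by ring.
  apply: (le_trans (ler_cmodD _ _)); have := fg z zr; rewrite cmodM.
  have zwk : cmod z <= cmod w + k by lra.
  have := hB z zwk; have := phi0 z zwk; rewrite ler_pdivlMr// => h1 h2.
  have {}h1 := h1
    ltac:(have := cmod_dist_triangle z w 0; rewrite !subr0 (cmodB w z); lra).
  have := cmod_ge0 (phi z); nra.
move=> v; rewrite inE => /predU1P[->|vs] z zv.
  rewrite (_ : _ - _ = - ((phi z - 1) * (f z - h (z - w)))); last by ring.
  rewrite cmodN cmodM (cmodB (f z)).
  have zwk : cmod z <= cmod w + k.
    by have := ler_cmodD (z - w) w; rewrite subrK; lra.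
  have := hB z zwk; have := phi1 z zv; rewrite ler_pdivlMr// => h1 h2.
  have := cmod_ge0 (phi z - 1); nra.
have vw : cmod v <= cmod w by exact: smin.
have zwk : cmod z <= cmod w + k.
  by have := ler_cmodD (z - v) v; rewrite subrK; lra.
rewrite (_ : _ - _ = (f z - h (z - v)) + phi z * (h (z - w) - f z)); last by ring.
apply: (le_trans (ler_cmodD _ _)); have := fh v vs z zv; rewrite cmodM.
have := hB z zwk; have := phi0 z zwk; rewrite ler_pdivlMr// => h1 h2.
have vws : v \in ws by apply: sws; rewrite inE vs orbT.
have vNw : v != w by apply: contraNneq wNs => <-.
have vwk := sep v w vws wws vNw.
have {}h1 := h1 ltac:(have := cmod_dist_triangle z v w; rewrite (cmodB v z); lra).
have := cmod_ge0 (phi z); nra.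
Qed.

End Runge.

(** * Covering an annulus *)

Section Groups.
Variables (R : realType) (x : nat -> R) (q : nat).
Hypotheses (x0 : forall n, 0 < x n) (xS : forall n, x n < x n.+1) (q0 : (0 < q)%N).
Hypothesis xdiv : forall B : R, exists n, B <= \sum_(i < n) (x i)^-1.

Definition slow_group g := x (q * g + q.-1) <= 2 * x (q * g).

(** Along a group that is not slow [x] more than doubles, so [(x (q * g))^-1] is at most twice the
    decrease of the inverse to the next group; these telescope to at most [2 * (x 0)^-1]. As a group
    contributes at most [q * (x (q * g))^-1] to the divergent series, the slow groups carry the
    divergence. *)
Lemma slow_group_sum (B : R) :
  exists G, B <= \sum_(g < G) (if slow_group g then (x (q * g))^-1 else 0).
Proof.
have xle : {homo x : n m / (n <= m)%N >-> n <= m}.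
  by apply: (homo_leq (@lexx _ R) (@le_trans _ R)) => n; exact: ltW.
have fast G : \sum_(g < G) (if slow_group g then 0 else (x (q * g))^-1) <=
    2 * ((x 0)^-1 - (x (q * G))^-1).
  elim: G => [|G IH]; first by rewrite big_ord0 muln0 subrr mulr0.
  rewrite big_ord_recr /=; have : (x (q * G.+1))^-1 <= (x (q * G))^-1.
    by rewrite lef_pV2 ?posrE//; apply: xle; rewrite leq_mul2l leqnSn orbT.
  case: ifPn => [_|]; first by lra.
  rewrite -ltNge => fG.
  have : (x (q * G.+1))^-1 <= (2 * x (q * G))^-1.
    rewrite lef_pV2 ?posrE ?mulr_gt0// (le_trans (ltW fG))// xle//.
    by rewrite mulnS addnC leq_add2r leq_pred.
  by rewrite invfM; lra.
have blocks G : \sum_(i < q * G) (x i)^-1 <= q%:R * \sum_(g < G) (x (q * g))^-1.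
  elim: G => [|G IH]; first by rewrite muln0 !big_ord0 mulr0.
  rewrite mulnS addnC big_split_ord [in leRHS]big_ord_recr /= mulrDr;
    apply: lerD => //.
  rewrite -[X in X%:R]card_ord mulr_natl -sumr_const; apply: ler_sum => i _.
  by rewrite lef_pV2 ?posrE//; apply: xle; rewrite leq_addr.
have qR : 0 < q%:R :> R by rewrite ltr0n.
have [n hn] := xdiv (q%:R * (B + 2 * (x 0)^-1)).
exists n; have : \sum_(i < n) (x i)^-1 <= \sum_(i < q * n) (x i)^-1.
  have /subnKC <- : (n <= q * n)%N by rewrite leq_pmull.
  rewrite big_split_ord /= lerDl; apply: sumr_ge0 => i _.
  by rewrite invr_ge0 ltW.
have := blocks n; have := fast n.
have -> : \sum_(g < n) (x (q * g))^-1
  = \sum_(g < n) (if slow_group g then (x (q * g))^-1 else 0)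
    + \sum_(g < n) (if slow_group g then 0 else (x (q * g))^-1).
  by rewrite -big_split /=; apply: eq_bigr => g _; case: ifP; rewrite ?addr0 ?add0r.
have xn0 : 0 < (x (q * n))^-1 by rewrite invr_gt0.
set S := \sum_(g < n) _; set T := \sum_(g < n) _ => h1 h2 h3.
have : q%:R * (B + 2 * (x 0)^-1) <= q%:R * (S + T) by lra.
by rewrite ler_pM2l//; lra.
Qed.

End Groups.

(** * Separated lattice points in thin annuli *)

Section Covering.
Variable R : realType.
Local Notation C := (Cplx R).

Lemma mem_int_box (b : nat) (t : int) : `|t| <= b%:Z ->
  t \in [seq i%:Z - b%:Z | i <- iota 0 (b + b).+1].
Proof.
move=> tb; apply/mapP; exists (absz (t + b%:Z)); last by lia.
by rewrite mem_iota; lia.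
Qed.

Definition lattice_point (e : R) (p : int * int) : C :=
  Complex (e * p.1%:~R) (e * p.2%:~R).

Lemma lattice_point_near (e : R) (a : C) : 0 < e ->
  exists p, cmod (a - lattice_point e p) <= 2 * e.
Proof.
move=> e0; exists (Num.floor (Re a / e), Num.floor (Im a / e)).
apply: (le_trans (ler_cmod_ReIm _)); rewrite ReB ImB /=.
have near t : `|t - e * (Num.floor (t / e))%:~R| <= e.
  have te : t = e * (t / e) by rewrite mulrC divfK// gt_eqF.
  rewrite [X in X - _]te -mulrBr normrM gtr0_norm// -[leRHS]mulr1 ler_pM2l//.
  have := floor_le_tmp (t / e); have := floorD1_gt (t / e).
  by rewrite intrD ler_norml; lra.
by rewrite mulr2n mulrDl mul1r; apply: lerD; exact: near.
Qed.

(** Two distinct points of one residue class differ by a nonzero multiple of [k] in some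
    coordinate. *)
Lemma lattice_point_sep (e : R) (k : nat) (p p' : int * int) : 0 <= e -> p <> p' ->
  (p.1 = p'.1 %[mod k])%Z -> (p.2 = p'.2 %[mod k])%Z ->
  e * k%:R <= cmod (lattice_point e p - lattice_point e p').
Proof.
have sep (u v : int) : u != v -> (u = v %[mod k])%Z -> k%:R <= `|u%:~R - v%:~R : R|.
  move=> uv /eqP; rewrite eqz_mod_dvd => /dvdzP[c uvc].
  rewrite -intrB uvc intrM normrM -[X in _ <= _ * X]/`|k%:R : R| normr_nat ler_peMl//.
  rewrite -intr_norm (ler_int R 1) -gtz0_ge1 normr_gt0.
  by apply: contraNneq uv => c0; rewrite -subr_eq0 uvc c0 mul0r.
case: p p' => [u v] [u' v'] e0 pp hu hv; rewrite /= in hu hv.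
have [uu|uu] := eqVneq u u'; last first.
  apply: le_trans (ler_Re_cmod _); rewrite ReB /= -mulrBr normrM ger0_norm//.
  by rewrite ler_wpM2l// sep.
apply: le_trans (ler_Im_cmod _); rewrite ImB /= -mulrBr normrM ger0_norm//.
rewrite ler_wpM2l// sep//; apply: contra_notN pp => /eqP ->.
by rewrite uu.
Qed.

(* At stage n, with g = n %/ q, the points used are those of a lattice of mesh
   e g = d / (4 x (q * g)) which have a residue class prescribed by n %% q and
   lie in a thin annulus around [rho g, rho g.+1].  The q stages of a group
   exhaust the residue classes; a group along which x more than doubles is
   skipped. *)
Lemma covering_points (r0 R0 d L A : R) : 0 < r0 -> 0 < d -> 0 < L ->
  exists2 M : R, 0 < M & forall mu : nat -> C,
    (forall n, M < cmod (mu n.+1) - cmod (mu n)) ->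
    (forall B : R, exists n, B <= \sum_(i < n) (cmod (mu i))^-1) ->
    0 < cmod (mu 0) -> A + d <= r0 * cmod (mu 0) ->
    exists (ws : seq C) (N : nat), [/\ {in ws, forall w, A <= cmod w},
      {in ws &, forall v w, v != w -> L <= cmod (v - w)} &
      forall a, r0 <= cmod a <= R0 -> exists w n,
        [/\ w \in ws, (n < N)%N & cmod (mu n * a - w) <= d]].
Proof.
(* On a slow group the mesh scaled by [x n] lies between [c] and [2 * c]. A lattice point within two
   meshes of [a] is thus sent within [4 * c = d] of [mu n * a]. *)
move=> r00 d0 L0; pose c := d / 4; have c0 : 0 < c by rewrite divr_gt0.
pose k := (Num.bound (L / c)).+1; pose q := (k * k)%N.
have q0 : (0 < q)%N by [].
have kL : L <= c * k%:R.
  rewrite mulrC -ler_pdivrMr// (le_trans (ltW (archi_boundP _)))//.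
    by rewrite divr_ge0 ?ltW.
  by rewrite ler_nat leqnSn.
(* The points of stage [n] have modulus between [x n * rho - 4 * c] and [x n * rho + 6 * c]; a gap
   of [L + 10 * c] after scaling by [r0] therefore separates different stages by [L]. *)
exists ((L + 10 * c) / r0); first by rewrite divr_gt0//; lra.
move=> mu gap mudiv mu0 muA.
pose x n := cmod (mu n).
have xS n : x n < x n.+1.
  rewrite -subr_gt0; apply: lt_trans (gap n).
  by rewrite divr_gt0//; lra.
have xle : {homo x : n m / (n <= m)%N >-> n <= m}.
  by apply: (homo_leq (@lexx _ R) (@le_trans _ R)) => n; exact: ltW.
have x0 n : 0 < x n by apply: lt_le_trans mu0 (xle _ _ (leq0n _)).
have xgap n m : (n < m)%N -> L + 10 * c <= (x m - x n) * r0.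
  move=> nm; rewrite -ler_pdivrMr//; apply: (le_trans (ltW (gap n))).
  by rewrite lerD2r; exact: xle.
pose slow := slow_group x q.
pose e (g : nat) := c / x (q * g).
have e0 g : 0 < e g by rewrite divr_gt0.
pose rho G := r0 + \sum_(g < G) (if slow g then e g else 0).
have rhoS g : rho g.+1 = rho g + (if slow g then e g else 0).
  by rewrite /rho big_ord_recr /= addrA.
have rho_le : {homo rho : n m / (n <= m)%N >-> n <= m}.
  apply: (homo_leq (@lexx _ R) (@le_trans _ R)) => n; rewrite rhoS lerDl.
  by case: ifP => // _; exact: ltW.
have rho0 g : r0 <= rho g.
  by apply: le_trans (rho_le _ _ (leq0n g)); rewrite /rho big_ord0 addr0.
have [G RG] : exists G, R0 < rho G.
  have [G hG] := slow_group_sum x0 xS q0 mudiv ((R0 - r0 + 1) / c).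
  exists G; rewrite /rho.
  have -> : \sum_(g < G) (if slow g then e g else 0) =
      c * \sum_(g < G) (if slow_group x q g then (x (q * g))^-1 else 0).
    by rewrite mulr_sumr; apply: eq_bigr => g _; rewrite /slow; case: ifP;
      rewrite ?mulr0.
  by move: hG; rewrite ler_pdivrMr// mulrC; lra.
pose b (n : nat) := (Num.bound ((rho (n %/ q)%N
  + 3 * e (n %/ q)%N) / e (n %/ q)%N))%N.
pose box n : seq int := [seq i%:Z - (b n)%:Z | i <- iota 0 (b n + b n).+1].
(* The two digits of [n %% q] in base [k] prescribe the residue class. The annulus is that of the
   [a] with [rho g <= cmod a < rho g + e g], enlarged by two meshes on each side. *)
pose ok (n : nat) (p : int * int) := [&& slow (n %/ q)%N,
  (p.1 == ((n %% q) %% k)%N %[mod k])%Z, (p.2 == ((n %% q) %/ k)%N %[mod k])%Z,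
  rho (n %/ q)%N - 2 * e (n %/ q)%N <= cmod (lattice_point (e (n %/ q)%N) p) &
  cmod (lattice_point (e (n %/ q)%N) p) <= rho (n %/ q)%N + 3 * e (n %/ q)%N].
pose pt (n : nat) (p : int * int) := mu n * lattice_point (e (n %/ q)%N) p.
pose ws := [seq pt np.1 np.2 | np <- [seq np <- [seq (n, p) | n <- iota 0 (q * G),
   p <- [seq (u, v) | u <- box n, v <- box n]] | ok np.1 np.2]].
have wsP w : w \in ws -> exists n p, ok n p /\ w = pt n p.
  by case/mapP => -[n p]; rewrite mem_filter => /andP[okp _] ->; exists n, p.
have xe n : slow (n %/ q)%N -> c <= x n * e (n %/ q)%N <= 2 * c.
  move=> sl; rewrite /e mulrA ler_pdivlMr// ler_pdivrMr//.
  have nE := divn_eq n q; have nq := ltn_pmod n q0.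
  have h1 : x (q * (n %/ q)%N) <= x n.
    by apply: xle; rewrite {2}nE mulnC leq_addr.
  have h2 : x n <= x (q * (n %/ q)%N + q.-1).
    by apply: xle; rewrite {1}nE mulnC leq_add2l -ltnS prednK.
  have := le_trans h2 sl; have := ler_wpM2r (ltW c0) h1; nra.
have cpt n p : ok n p ->
    x n * rho (n %/ q)%N - 4 * c <= cmod (pt n p) <= x n * rho (n %/ q)%N + 6 * c.
  move=> /and5P[/xe/andP[_ xec] _ _ lo hi]; rewrite /pt cmodM -/(x n).
  have := ler_wpM2l (ltW (x0 n)) lo; have := ler_wpM2l (ltW (x0 n)) hi.
  by move=> h1 h2; apply/andP; split; lra.
exists ws, (q * G)%N; split.
- move=> w /wsP[n [p [/cpt/andP[h _] ->]]]; apply: le_trans h.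
  have : x 0 * r0 <= x n * rho (n %/ q)%N.
    by apply: ler_pM => //; [exact: ltW|exact: ltW|exact: xle].
  by rewrite mulrC -/(x 0) in muA *; rewrite /c; lra.
- have sep_lt n p n' p' : (n < n')%N -> ok n p -> ok n' p' ->
      L <= cmod (pt n' p' - pt n p).
    move=> nn' /cpt/andP[_ h1] /cpt/andP[h2 _].
    have := cmod_dist_triangle (pt n p) (pt n' p') 0; rewrite !subr0.
    have g1 : rho (n %/ q)%N <= rho (n' %/ q)%N by apply: rho_le;
      rewrite leq_div2r// ltnW.
    have := xgap _ _ nn'; have := ler_wpM2l (ltW (x0 n')) g1.
    have xx : 0 <= x n' - x n by rewrite subr_ge0 xle// ltnW.
    have := ler_wpM2l xx (rho0 (n %/ q)%N).
    lra.
  move=> v w /wsP[n [p [okp ->]]] /wsP[n' [p' [okp' ->]]] vw.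
  have [nn'|nn'|nn'] := ltngtP n n'; [|exact: sep_lt|].
    by rewrite cmodB sep_lt.
  move: vw okp'; rewrite -nn' => vw okp'.
  have pp : p <> p' by move=> E; rewrite E eqxx in vw.
  rewrite /pt -mulrBr cmodM -/(x n).
  case/and5P: okp => /xe/andP[xec _] /eqP p1 /eqP p2 _ _.
  case/and5P: okp' => _ /eqP p1' /eqP p2' _ _.
  have := lattice_point_sep (ltW (e0 (n %/ q)%N)) pp (etrans p1 (esym p1')) (etrans
    p2 (esym p2')).
  move=> /(ler_wpM2l (ltW (x0 n))); apply: le_trans; apply: (le_trans kL).
  by rewrite mulrA ler_wpM2r.
move=> a /andP[ra aR].
(* The group is found from the first index at which [rho] exceeds [cmod a]; as [rho] increases
   strictly there, the group is slow. *)
have [g gG /andP[ga ag]] : exists2 g, (g < G)%N & rho g <= cmod a < rho g.+1.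
  have exG : exists G, cmod a < rho G by exists G; exact: le_lt_trans RG.
  case: (ex_minnP exG) => -[|g] ag gmin.
    by move: ag; rewrite /rho big_ord0 addr0 ltNge ra.
  exists g; first by apply: gmin; exact: le_lt_trans RG.
  by rewrite ag andbT leNgt; apply/negP => /gmin; rewrite ltnn.
have sg : slow g by apply: contraTT ag => /negbTE sg; rewrite -leNgt rhoS sg addr0.
have {}ag : cmod a < rho g + e g by move: ag; rewrite rhoS sg.
have [p ap] := lattice_point_near a (e0 g).
have [u uE] : exists u : nat, (p.1 %% k)%Z = u%:Z.
  by exists (absz (p.1 %% k)%Z); rewrite gez0_abs ?modz_ge0.
have [v vE] : exists v : nat, (p.2 %% k)%Z = v%:Z.
  by exists (absz (p.2 %% k)%Z); rewrite gez0_abs ?modz_ge0.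
have uk : (u < k)%N by rewrite -ltz_nat -uE ltz_pmod.
have vk : (v < k)%N by rewrite -ltz_nat -vE ltz_pmod.
(* The stage inside group [g] whose residue class is that of [p]. *)
pose j := (v * k + u)%N; pose n := (g * q + j)%N.
have jq : (j < q)%N.
  by apply: leq_trans (_ : v.+1 * k <= _)%N;
    [rewrite mulSnr ltn_add2l|rewrite leq_mul2r vk orbT].
have nq : (n %/ q = g)%N by rewrite divnMDl// divn_small// addn0.
have nr : (n %% q = j)%N by rewrite modnMDl modn_small.
have ju : (j %% k = u)%N by rewrite modnMDl modn_small.
have jv : (j %/ k = v)%N by rewrite divnMDl// divn_small// addn0.
have t1 := cmod_dist_triangle (lattice_point (e g) p) a 0.
have t2 := cmod_dist_triangle a (lattice_point (e g) p) 0.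
rewrite !subr0 in t1 t2; rewrite (cmodB (lattice_point _ _) a) in t2.
have okp : ok n p.
  rewrite /ok nq nr ju jv sg -uE -vE !modz_mod !eqxx !andTb.
  by apply/andP; split; lra.
exists (pt n p), n.
have nN : (n < q * G)%N.
  apply: leq_trans (_ : g.+1 * q <= _)%N; first by rewrite mulSnr ltn_add2l.
  by rewrite mulnC leq_mul2l gG orbT.
have inbox (t : int) : `|e g * t%:~R| <= cmod (lattice_point (e g) p) -> t \in box n.
  move=> ht.
  have tb : `|t%:~R| <= (b n)%:R :> R.
    apply: le_trans (ltW (archi_boundP _)); last first.
      apply: divr_ge0; last exact: ltW.
      by have := rho0 (n %/ q)%N; have := e0 (n %/ q)%N; lra.
    rewrite nq ler_pdivlMr// mulrC -[X in X * _]gtr0_norm// -normrM.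
    by apply: (le_trans ht); lra.
  rewrite -intr_norm -[(b n)%:R]/((b n)%:~R) ler_int in tb.
  exact: mem_int_box.
split=> //.
  apply/mapP; exists (n, p) => //; rewrite mem_filter; apply/andP; split=> //.
  apply: allpairs_f_dep; first by rewrite mem_iota add0n.
  case: p {ap uE vE t1 t2 okp} inbox => p1 p2 inbox.
  apply: allpairs_f; apply: inbox.
    exact: (ler_Re_cmod (lattice_point _ (_, _))).
  exact: (ler_Im_cmod (lattice_point _ (_, _))).
rewrite /pt nq -mulrBr cmodM -/(x n).
have := ler_wpM2l (ltW (x0 n)) ap; have := xe n; rewrite nq => /(_ sg)/andP[_].
by rewrite /c; lra.
Qed.

End Covering.

(** * The topology of H *)

Section Topology.
Variable R : realType.
Local Notation C := (Cplx R).

Definition disc_nbhd (f : H R) (r e : R) : set (H R) :=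
  [set g | forall z, cmod z <= r -> cmod (Hfun g z - Hfun f z) < e].

Lemma entourage_cmodP (E : set (C * C)) : entourage E <->
  exists2 e : R, 0 < e & forall z w, cmod (w - z) < e -> E (z, w).
Proof.
rewrite -entourage_from_ballE; split=> [[e /= e0 eE]|[e e0 eE]].
  have ee : e = cplx (Re e) by move/gtr0_real/RRe_real : e0.
  exists (Re e) => [|z w zw]; first by rewrite -ltcR -[ltRHS]/(cplx (Re e)) -ee.
  by apply: eE; rewrite /= -ball_normE /ball_ /= distrC cmodE ee ltcR.
exists (cplx e); first by rewrite /= ltcR.
by move=> [z w]; rewrite /= -ball_normE /ball_ /= distrC cmodE ltcR => /eE.
Qed.

(** Compact sets are bounded, and every disc lies in a compact set, so discs suffice to describe
    uniform convergence on compact sets. *)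
Lemma nbhs_HP (f : H R) (A : set (H R)) :
  nbhs f A <-> exists r e : R, 0 < e /\ disc_nbhd f r e `<=` A.
Proof.
pose T := {family compact, C -> C}.
split=> [[_ [[B oB <-] /= Bf BA]]|[r [e [e0 hA]]]].
  pose base (i : R * R) : set T :=
    [set g | forall z, cmod z <= i.1 -> cmod (g z - Hfun f z) < i.2].
  (* The filter generated by these sets converges to [f] uniformly on every compact set, so it
     contains the open set [B]. *)
  pose F := filter_from [set i : R * R | 0 < i.2] base.
  have FF : Filter F.
    apply: filter_from_filter; first by exists (0, 1) => /=.
    move=> [r1 e1] [r2 e2] /= e10 e20.
    exists (Num.max r1 r2, Num.min e1 e2) => [|g hg]; first by rewrite /= lt_min e10.
    split=> z /= zr; have := hg z; rewrite /= le_max zr ?orbT lt_min =>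
      /(_ isT) /andP[]//.
  have Fcvg : {family compact, F --> (Hfun f : C -> C)}.
    apply/fam_cvgP => K cK P /uniform_nbhs[E [/entourage_cmodP[e e0 eE] EP]].
    have [r Kr] := compact_cmod_bounded cK.
    exists (r, e) => // g hg; apply: EP => z Kz; apply: eE; apply: hg.
    exact: Kr.
  have [[r e] /= e0 hB] : F B.
    by apply: Fcvg; apply: open_nbhs_nbhs.
  by exists r, e; split=> // g hg; apply: BA; apply: hB.
have [K cK rK] := closed_ball_compact r.
pose E : set (C * C) := [set zw | cmod (zw.2 - zw.1) < e].
have entE : entourage E by apply/entourage_cmodP; exists e.
pose W : set T := [set g | forall z, K z -> E (Hfun f z, g z)].
have fW : nbhs (Hfun f : T) W by exact: fam_nbhs.
have : nbhs f ((set_val : H R -> T) @^-1` W).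
  exact: (@initial_continuous (H R) T set_val f W fW).
by apply: filterS => g hg; apply: hA => z /rK; exact: hg.
Qed.

Lemma nbhs_disc_nbhd (f : H R) (r e : R) : 0 < e -> nbhs f (disc_nbhd f r e).
Proof. by move=> e0; apply/nbhs_HP; exists r, e; split. Qed.

Definition mkH (f : C -> C) (ef : entire f) : H R :=
  exist _ (f : {family compact, C -> C}) (mem_set ef).

(* A limit of the nested discs is entire by entire_limit, so that H is a Baire
   space. *)
Lemma H_Baire (O : nat -> set (H R)) : (forall n, open (O n)) ->
  (forall n, dense (O n)) -> dense (\bigcap_n O n).
Proof.
move=> oO dO U [f0 Uf0] oU.
pose V (s : H R * (R * R)) : set (H R) :=
  [set g | forall z, cmod z <= s.2.1 -> cmod (Hfun g z - Hfun s.1 z) <= s.2.2].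
have VS f (A : set (H R)) (a : R) (b : R) : nbhs f A -> 0 < a ->
    exists s : H R * (R * R), [/\ s.1 = f, 0 < s.2.2 <= a, b <= s.2.1 & V s `<=` A].
  move=> /nbhs_HP[r1 [e1 [e10 hA]]] a0.
  exists (f, (Num.max r1 b, Num.min (e1 / 2) a)); split=> //=.
  - by rewrite lt_min a0 ge_min lexx orbT divr_gt0.
  - by rewrite le_max lexx orbT.
  - move=> g hg; apply: hA => z zr; have := hg z;
    rewrite /= le_max zr le_min => /(_ isT) /andP[].
    by move=> /le_lt_trans + _; apply; lra.
have [s0 [_ /andP[s00 _] _ s0U]] := VS f0 U 1 0 (open_nbhs_nbhs (conj oU Uf0)) ltr01.
have /choice[nxt nxtP] (ns : nat * (H R * (R * R))) : exists s', 0 < ns.2.2.2 ->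
    [/\ 0 < s'.2.2 <= ns.2.2.2 / 2, ns.1.+1%:R
      <= s'.2.1 & V s' `<=` V ns.2 `&` O ns.1].
  case: ns => n [f [r e]] /=.
  have [e0|] := pselect (0 < e); last by exists (f, (r, e)).
  (* Density is applied to the interior, since [disc_nbhd] is only known to be a neighbourhood. *)
  have fI := nbhs_interior (nbhs_disc_nbhd f r e0).
  have [f' [If' Of']] : (disc_nbhd f r e)° `&` O n !=set0.
    apply: dO; last exact: open_interior.
    by exists f; exact: nbhs_singleton.
  have fA : nbhs f' (disc_nbhd f r e `&` O n).
    by apply: filterI => //; apply: open_nbhs_nbhs; split.
  have e20 : 0 < e / 2 by rewrite divr_gt0.
  have [s' [_ h1 h2 h3]] := VS f' _ (e / 2) n.+1%:R fA e20.
  exists s' => _; split=> // g /h3[gf gO]; split=> // z zr.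
  exact/ltW/gf.
pose st := fix st n := if n is n'.+1 then nxt (n', st n') else s0.
have st0 n : 0 < (st n).2.2.
  by elim: n => [//|n IH]; have [/andP[]] := nxtP (n, st n) IH.
have stS n := nxtP (n, st n) (st0 n).
have Vdec : {homo (fun n => V (st n)) : n m / (n <= m)%N >-> m `<=` n}.
  apply: (homo_leq (r := fun a b : set (H R) => b `<=` a)).
  - by move=> a g.
  - by move=> a b c ab bc; exact: subset_trans bc ab.
  - by move=> n; have [_ _] := stS n => h g /h[].
have Vst n m : (n <= m)%N -> V (st n) (st m).1.
  move=> /Vdec; apply=> z _; rewrite subrr cmod0; exact: ltW.
have rad n : n%:R <= (st n.+1).2.1 by have [_ + _] := stS n; apply: le_trans;
  rewrite ler_nat.
have err n : (st n).2.2 <= 2^-1 ^+ n * s0.2.2.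
  elim: n => [|n IH]; first by rewrite expr0 mul1r.
  have [/andP[_ h] _ _] := stS n; apply: (le_trans h).
  by rewrite exprSr mulrAC ler_pM2r// invr_gt0.
(* From stage [n] on, the values at [z] stay within [(st n).2.2] of the value at stage [n], once its
   disc contains [z]; a cluster point of the values inherits all these bounds. *)
have /choice[f fP] (z : C) : exists d, forall n, cmod z <= (st n).2.1 ->
    cmod (d - Hfun (st n).1 z) <= (st n).2.2.
  have [n0 zn0] : exists n, cmod z <= (st n).2.1.
    exists (Num.bound (cmod z)).+1; apply: le_trans (rad _).
    by apply/ltW/archi_boundP; exact: cmod_ge0.
  have [K cK BK] := closed_ball_compact (cmod (Hfun (st n0).1 z) + (st n0).2.2).
  pose u n := Hfun (st n).1 z.
  have [|d [_ ud]] := cK (u @ \oo) _.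
    exists n0 => // m /= /Vst h; apply: BK; rewrite -(subrK (Hfun (st n0).1 z) (u m)).
    by apply: (le_trans (ler_cmodD _ _)); rewrite addrC lerD2l; exact: h.
  exists d => n zn; apply/ler_addgt0Pr => eps eps0.
  have [] := ud (u @` [set m | (n <= m)%N]) [set w | cmod (w - d) < eps].
  - by exists n => // m /= nm; exists m.
  - exact: nbhs_cmod_lt.
  move=> _ [[m /= nm <-] umd].
  apply: (le_trans (cmod_dist_triangle (u m) _ _)); rewrite addrC cmodB.
  by apply: lerD; [rewrite cmodB; exact: (Vst _ _ nm)|rewrite cmodB; exact: ltW].
have ef : entire f.
  apply: entire_limit => r e e0.
  have h0 : 0 <= 2^-1 :> R by rewrite invr_ge0.
  have h1 : 2^-1 < 1 :> R by rewrite invf_lt1// ltr1n.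
  have [N hN] := exists_expr_le h0 h1 (divr_gt0 e0 s00).
  pose n := (maxn N (Num.bound `|r|)).+1.
  exists (Hfun (st n).1); first exact: entire_Hfun.
  move=> z zr; apply: le_trans (_ : (st n).2.2 <= _).
    apply: fP; apply: le_trans (rad _); apply: (le_trans zr).
    apply: (le_trans (ler_norm r)); apply: le_trans (ltW (archi_boundP _)) _ => //.
    by rewrite ler_nat leq_maxr.
  apply: (le_trans (err _)); rewrite -ler_pdivlMr//; apply: le_trans hN.
  by rewrite ler_wiXn2l// ?ltW// ltnW// ltnS leq_maxl.
have fV n : V (st n) (mkH ef) by move=> z /fP.
exists (mkH ef); split; first exact/s0U/(fV 0%N).
by move=> n _; have [_ _ h] := stS n; have [] := h _ (fV n.+1).
Qed.

End Topology.

(** * Common approximation *)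

Section DensePolynomials.
Variable R : realType.
Local Notation C := (Cplx R).

Definition ratc (p : rat * rat) : C := Complex (ratr p.1) (ratr p.2).

(** An enumeration by [nat] of the polynomials with Gaussian rational coefficients; an index that
    codes no list gives the zero polynomial. *)
Definition rat_poly (j : nat) : {poly C} :=
  Poly (map ratc (odflt [::] (unpickle j))).

Lemma ratc_dense (c : C) (e : R) : 0 < e -> exists p, cmod (c - ratc p) <= e.
Proof.
move=> e0; have near (x : R) : exists q : rat, `|x - ratr q| <= e / 2.
  have [q] : exists q : rat, ratr q \in `](x - e / 2), (x + e / 2)[%R.
    by apply: rat_in_itvoo; lra.
  by rewrite in_itv /= => h; exists q; rewrite ler_norml; lra.
have [q1 h1] := near (Re c); have [q2 h2] := near (Im c).
exists (q1, q2); apply: (le_trans (ler_cmod_ReIm _)).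
by rewrite ReB ImB /=; lra.
Qed.

Lemma rat_poly_dense (f : C -> C) (r e : R) : entire f -> 0 < e ->
  exists j, forall z, cmod z <= r -> cmod (f z - (rat_poly j).[z]) <= e.
Proof.
move=> ef e0; have e20 : 0 < e / 2 by lra.
have [p fp] := entire_poly_approx r ef e20.
(* Coefficients are replaced one at a time along Horner's scheme; dividing the tolerance by
   [|r| + 1] absorbs the multiplication by [z]. *)
have approx (s : seq C) d : 0 < d -> exists t : seq (rat * rat),
    forall z, cmod z <= r -> cmod ((Poly s).[z] - (Poly (map ratc t)).[z]) <= d.
  elim: s d => [|c s IH] d d0.
    by exists [::] => z _; rewrite subrr cmod0 ltW.
  have d20 : 0 < d / 2 by lra.
  have r1 : 0 < `|r| + 1 by have := normr_ge0 r; lra.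
  have [t st] := IH _ (divr_gt0 d20 r1); have [q cq] := ratc_dense c d20.
  exists (q :: t) => z zr; rewrite /= !cons_poly_def !hornerMXaddC.
  rewrite (_ : _ - _ = ((Poly s).[z] - (Poly (map ratc t)).[z]) * z + (c - ratc q));
    last by ring.
  apply: (le_trans (ler_cmodD _ _)); rewrite cmodM.
  have := st z zr; rewrite ler_pdivlMr// => h1.
  have zr' : cmod z <= `|r| + 1 by have := ler_norm r; lra.
  have := ler_wpM2l (cmod_ge0 ((Poly s).[z] - (Poly (map ratc t)).[z])) zr'; lra.
have [t pt] := approx p _ e20.
exists (pickle t) => z zr; rewrite /rat_poly pickleK /=.
have := pt z zr; have := fp z zr; rewrite polyseqK.
have := cmod_dist_triangle p.[z] (f z) (Poly (map ratc t)).[z]; lra.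
Qed.

End DensePolynomials.

(** * Open dense sets describing common hypercyclicity *)

Section CommonApproximation.
Variable R : realType.
Local Notation C := (Cplx R).
Variable lambda : nat -> C.

(* The strict inequality eta < k.+1%:R^-1, uniform in a, makes this set open. *)
Definition common_approx (N k j : nat) : set (H R) :=
  [set f | exists (m : nat) (eta : R), eta < k.+1%:R^-1 /\
    forall a : C, N.+1%:R^-1 <= cmod a <= N.+1%:R ->
      exists2 n, (n < m)%N & forall z, cmod z <= k%:R ->
        cmod (Hfun f (z + lambda n * a) - (rat_poly R j).[z]) <= eta].

Lemma common_approx_open N k j : open (common_approx N k j).
Proof.
rewrite openE => f [m [eta [etak hf]]]; apply/nbhs_HP; set t := k.+1%:R^-1 in etak.
(* A disc containing all [z + lambda n * a] with [n < m], the sum being a crude bound for each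
   modulus; half the slack in [eta] is spent on moving [f]. *)
exists (k%:R + (\sum_(n < m) cmod (lambda n)) * N.+1%:R), ((t - eta) / 2).
split; first by lra.
move=> g hg; exists m, ((t + eta) / 2); split; first by rewrite -/t; lra.
move=> a aN; have [n nm hn] := hf a aN; exists n => // z zk.
apply: (le_trans (cmod_dist_triangle (Hfun f (z + lambda n * a)) _ _)).
have := hn z zk; have : cmod (Hfun g (z + lambda n * a) - Hfun f (z
  + lambda n * a)) < (t - eta) / 2.
  apply: hg; apply: (le_trans (ler_cmodD _ _)); apply: lerD => //.
  rewrite cmodM; apply: ler_pM; rewrite ?cmod_ge0//; last by case/andP: aN.
  by rewrite (bigD1 (Ordinal nm))//= lerDl sumr_ge0// => i _; exact: cmod_ge0.
lra.
Qed.

(** For each [a] some index [n] works, and by uniform continuity of [f] it still works near [a].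
    Compactness of the range of [a] then bounds [n]. *)
Lemma HC_common_approx f N k j : (forall a : C, a != 0 -> HC lambda a f) ->
  common_approx N k j f.
Proof.
move=> hf; pose t : R := k.+1%:R^-1; have t0 : 0 < t by rewrite invr_gt0.
have [K cK NK] := closed_ball_compact (N.+1%:R : R).
suff [m _ hm] : \forall m \near \oo, K `<=` (fun a : C => N.+1%:R^-1 <= cmod a ->
    exists2 n, (n < m)%N & forall z, cmod z <= k%:R ->
        cmod (Hfun f (z + lambda n * a) - (rat_poly R j).[z]) <= 3 / 4 * t).
  exists m, (3 / 4 * t); split; first by rewrite -/t; lra.
  by move=> a /andP[aN Na]; apply: (hm m (leqnn m)) => //; exact: NK.
apply: (compact_near_coveringP K).1 cK _ _ _ _ _ => a _.
(* The compact set may contain 0, near which the condition on [a] is void. *)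
have [->|a0] := eqVneq a 0.
  exists ([set b | cmod (b - 0) < N.+1%:R^-1], setT) => /=.
    by split; [apply: nbhs_cmod_lt; rewrite invr_gt0|exact: filterT].
  by move=> [b m] /= [+ _]; rewrite subr0 ltNge => /negP.
pose q := mkH (@entire_horner R (rat_poly R j)).
have t20 : 0 < t / 2 by lra.
have [h [/interior_subset qh [n _ hE]]] :
    (disc_nbhd q k%:R (t / 2))° `&` [set translation (lambda n * a) f | n in setT]
      !=set0.
  apply: (hf a a0); last exact: open_interior.
  by exists q; apply: nbhs_singleton; apply: nbhs_interior; exact: nbhs_disc_nbhd.
have {qh} qf : disc_nbhd q k%:R (t / 2) (translation (lambda n * a) f) by rewrite hE.
have t40 : 0 < t / 4 by lra.
have [d d0 hd] := entire_unif_continuous (k%:R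
  + cmod (lambda n * a)) (entire_Hfun f) t40.
have L0 : 0 < cmod (lambda n) + 1 by have := cmod_ge0 (lambda n); lra.
exists ([set b | cmod (b - a) < d / (cmod (lambda n) + 1)], [set m | (n < m)%N]) =>
  /=.
  by split; [apply: nbhs_cmod_lt; exact: divr_gt0|exists n.+1].
move=> [b m] /= [ba nm] _; exists n => // z zk.
apply: (le_trans (cmod_dist_triangle (Hfun f (z + lambda n * a)) _ _)).
have h1 : cmod (Hfun f (z + lambda n * a) - (rat_poly R j).[z]) < t / 2
  by exact: (qf z zk).
have h2 : cmod (Hfun f (z + lambda n * b) - Hfun f (z + lambda n * a)) < t / 4.
  apply: hd; first by apply: (le_trans (ler_cmodD _ _)); rewrite lerD2r.
  rewrite (_ : _ - _ = lambda n * (b - a)); last by ring.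
  rewrite cmodM; move: ba; rewrite ltr_pdivlMr//.
  by have := cmod_ge0 (b - a); nra.
lra.
Qed.

Lemma common_approx_HC f : (forall N k j, common_approx N k j f) ->
  forall a : C, a != 0 -> HC lambda a f.
Proof.
move=> hf a a0 U [g Ug] oU.
have [r [e [e0 gU]]] := (nbhs_HP g U).1 (open_nbhs_nbhs (conj oU Ug)).
have ca : 0 < cmod a by rewrite cmod_gt0.
have bnd (x : R) : x < (Num.bound `|x|).+1%:R.
  apply: (le_lt_trans (ler_norm x)); apply: lt_trans (archi_boundP _) _ => //.
  by rewrite ltr_nat.
(* [N] bounds both [cmod a] and its inverse; [k] exceeds [r] and makes the tolerance at most
   [e / 2]. *)
pose N := maxn (Num.bound `|cmod a|) (Num.bound `|(cmod a)^-1|).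
pose k := maxn (Num.bound `|r|).+1 (Num.bound `|(e / 2)^-1|).
have e20 : 0 < e / 2 by lra.
have [j hj] := rat_poly_dense r (entire_Hfun g) e20.
have aN : N.+1%:R^-1 <= cmod a <= N.+1%:R.
  rewrite -[X in _ <= X <= _]invrK lef_pV2 ?posrE ?invr_gt0//.
  apply/andP; split; apply: (le_trans (ltW (bnd _))).
    by rewrite ler_nat ltnS leq_maxr.
  by rewrite ler_nat ltnS invrK leq_maxl.
have [m [eta [etak /(_ a aN)[n _ hn]]]] := hf N k j.
exists (translation (lambda n * a) f); split; last by exists n.
apply: gU => z zr; apply: (le_lt_trans (cmod_dist_triangle (rat_poly R j).[z] _ _)).
have h1 := hj z zr; rewrite cmodB in h1.
have zk : cmod z <= k%:R.
  by rewrite (le_trans zr)// (le_trans (ltW (bnd _)))// ler_nat leq_maxl.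
have h2 := hn z zk.
have ke : k.+1%:R^-1 <= e / 2.
  rewrite -[leRHS]invrK lef_pV2 ?posrE ?invr_gt0//.
  by apply: (le_trans (ltW (bnd _))); rewrite ler_nat ltnS leq_maxr.
have ee := lt_le_trans etak ke.
by rewrite [Hfun _ z]/(Hfun f (z + lambda n * a)); lra.
Qed.

Hypothesis lambda_sub : forall M : R, 0 < M ->
  exists2 phi : nat -> nat, increasing_seq phi &
    let mu := lambda \o phi in
    (forall n, M < cmod (mu n.+1) - cmod (mu n)) /\
    (\sum_(0 <= n <oo) ((cmod (mu n))^-1)%:E = +oo)%E.

Lemma separated_tail (M B : R) : 0 < M -> exists phi : nat -> nat,
  [/\ {homo phi : n m / (n <= m)%N},
    forall n, M < cmod (lambda (phi n.+1)) - cmod (lambda (phi n)),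
    forall b : R, exists n, b <= \sum_(i < n) (cmod (lambda (phi i)))^-1 &
    B <= cmod (lambda (phi 0))].
Proof.
move=> M0; have [phi phiS [gap div]] := lambda_sub M0.
pose x n := cmod (lambda (phi n)).
have xn n : n%:R * M <= x n.
  elim: n => [|n IH]; first by rewrite mul0r cmod_ge0.
  by have := gap n; rewrite /= -/(x n) -/(x n.+1) -addn1 natrD; lra.
pose n0 := Num.bound (`|B| / M).
exists (fun n => phi (n0 + n)%N); split.
- by move=> n m nm; have := phiS (n0 + n)%N (n0 + m)%N; rewrite leq_add2l nm.
- by move=> n; rewrite addnS; exact: gap.
- move=> b; apply: contrapT => /forallNP nb.
  suff : (\sum_(0 <= n <oo) ((x n)^-1)%:E <= (b + \sum_(i < n0) (x i)^-1)%:E)%E.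
    by rewrite div leye_eq.
  apply: lime_le.
    by apply: is_cvg_nneseries => n _ _; rewrite lee_fin invr_ge0 cmod_ge0.
  exists n0 => // n /= n0n; rewrite sumEFin lee_fin big_mkord -(subnKC n0n).
  rewrite big_split_ord /= addrC lerD2r.
  by have /negP := nb (n - n0)%N; rewrite -ltNge => /ltW.
- rewrite addn0; apply: (le_trans (ler_norm B)); apply: le_trans (xn n0).
  rewrite -ler_pdivrMr//; apply/ltW/archi_boundP.
  by rewrite divr_ge0 ?(ltW M0).
Qed.

(** [covering_points] supplies the centres and [runge_discs] the function, which copies the
    polynomial around each centre; uniform continuity of the polynomial absorbs the displacement
    [lambda n * a - w]. *)
Lemma common_approx_dense N k j : dense (common_approx N k j).
Proof.
move=> U [g Ug] oU.
have [r [e [e0 gU]]] := (nbhs_HP g U).1 (open_nbhs_nbhs (conj oU Ug)).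
pose q z := (rat_poly R j).[z]; have eq : entire q := @entire_horner R _.
pose t : R := k.+1%:R^-1; have t0 : 0 < t by rewrite invr_gt0.
have t40 : 0 < t / 4 by lra.
have [d0 d00 qd] := entire_unif_continuous k%:R eq t40.
pose d := Num.min (d0 / 2) 1.
have dp : 0 < d by rewrite lt_min ltr01 divr_gt0.
have dd0 : d < d0 by apply: (le_lt_trans (_ : d <= d0 / 2));
  [rewrite ge_min lexx|lra].
have d1 : d <= 1 by rewrite ge_min lexx orbT.
(* The disc of radius [k] displaced by at most [d <= 1] stays in the disc of radius [kap]. *)
pose kap : R := k%:R + 1; have kap0 : 0 < kap by rewrite ltr_wpDl.
have N0 : 0 < N.+1%:R^-1 :> R by rewrite invr_gt0.
have L0 : 0 < 421 * kap by lra.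
pose A := `|r| + 420 * kap.
have [M M0 cover] := covering_points N.+1%:R A N0 dp L0.
(* This bound is the starting condition of [covering_points] for the inner radius [N.+1%:R^-1]; the
   added 1 makes the first modulus positive. *)
have [phi [phiS gap div big]] := separated_tail (`|A + d| * N.+1%:R + 1) M0.
have [ws [n0 [wsA wsL wsC]]] : exists (ws : seq C) (N' :
  nat), [/\ {in ws, forall w, A <= cmod w},
      {in ws &, forall v w, v != w -> 421 * kap <= cmod (v - w)} &
      forall a, N.+1%:R^-1 <= cmod a <= N.+1%:R -> exists w n,
        [/\ w \in ws, (n < N')%N & cmod (lambda (phi n) * a - w) <= d]].
  have Ad0 : 0 <= `|A + d| * N.+1%:R by rewrite mulr_ge0.
  apply: (cover (fun n => lambda (phi n))) => //; first by lra.
  rewrite mulrC ler_pdivlMr//; apply: le_trans big.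
  have := ler_wpM2r (ler0n R N.+1) (ler_norm (A + d)); lra.
pose eta := Num.min (e / 2) (t / 4).
have eta0 : 0 < eta by rewrite lt_min divr_gt0.
have [f [ef fg fq]] := runge_discs kap0 eta0 (entire_Hfun g) eq wsA wsL (normr_ge0 r).
exists (mkH ef); split.
  apply: gU => z zr; apply: le_lt_trans (fg z (le_trans zr (ler_norm r))) _.
  by apply: (le_lt_trans (_ : eta <= e / 2)); [rewrite ge_min lexx|lra].
(* As [phi] is monotone, [phi n0] bounds every index used. The error is [t / 4] from [runge_discs]
   plus [t / 4] from the displacement. *)
exists (phi n0).+1, (t / 2); split; first by rewrite -/t; lra.
move=> a /wsC[w [n [ws_w nn0 naw]]]; exists (phi n) => [|z zk].
  by rewrite ltnS phiS// ltnW.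
pose v := lambda (phi n) * a - w.
have zv : z + lambda (phi n) * a - w = z + v by rewrite /v addrA.
apply: (le_trans (cmod_dist_triangle (q (z + v)) _ _)).
have := fq w ws_w (z + lambda (phi n) * a); rewrite zv.
have vd : cmod v <= d := naw.
have zvk : cmod (z + v) <= kap by apply: (le_trans (ler_cmodD _ _)); rewrite /kap;
  lra.
move=> /(_ zvk) h1.
have : eta <= t / 4 by rewrite ge_min lexx orbT.
have := qd z (z + v) zk; rewrite addrAC subrr add0r => /(_ (le_lt_trans vd dd0)).
have -> : Hfun (mkH ef) = f by [].
rewrite -/(q z); lra.
Qed.

End CommonApproximation.

Theorem theorem1p1 (R : realType) (lambda : (Cplx R)^nat)
    (lambda_neq0 : forall n, lambda n != 0)
    (lambda_infty : (fun n => cmod (lambda n)) @ \oo --> +oo)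
    (lambda_sub : forall M : R, 0 < M ->
      exists2 phi : nat -> nat, increasing_seq phi &
        let mu := lambda \o phi in
        (forall n, M < cmod (mu n.+1) - cmod (mu n)) /\
        (\sum_(0 <= n <oo) ((cmod (mu n))^-1)%:E = +oo)%E) :
  let S := \bigcap_(a in [set a : Cplx R | a != 0]) HC lambda a in
  Gdelta S /\ dense S.
Proof.
(* Triples are coded by natural numbers to give a countable family; an index that codes no triple
   yields the whole space, which is open and dense. *)
pose O i : set (H R) := if unpickle i is Some (N, k,
  j) then common_approx lambda N k j else setT.
have -> : \bigcap_(a in [set a : Cplx R | a != 0]) HC lambda a = \bigcap_i O i.
  apply/seteqP; split=> f hf.
    move=> i _; rewrite /O; case: unpickle => [[[N k] j]|//].
    by apply: HC_common_approx => a; exact: hf.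
  move=> a a0; apply: common_approx_HC a a0 => N k j.
  by have := hf (pickle (N, k, j)) I; rewrite /O pickleK.
have oO i : open (O i).
  by rewrite /O; case: unpickle => [[[N k] j]|];
    [exact: common_approx_open|exact: openT].
split; first by exists O.
apply: H_Baire => // i; rewrite /O; case: unpickle => [[[N k] j]|].
  exact: common_approx_dense.
by move=> U U0 _; rewrite setIT.
Qed.
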